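(* Consider the setting, the assumptions on $f$, and the algorithm (ALG) given in the context. Assume that: (1) $F(x)\to+\infty$ as $\|x\|\to+\infty$; (2) the continuous functions $\mathsf h,\mathsf r,\mathsf p,\mathsf q:(0,+\infty)\to\mathbb{R}_+$ satisfy: $\mathsf h$ is $C^1$ with $\dot{\mathsf h}\le0$ on $(0,+\infty)$ and $h_\infty:=\lim_{t\to\infty}\mathsf h(t)>0$; $\mathsf r,\mathsf q$ are non-increasing with $r_\infty:=\lim_{t\to\infty}\mathsf r(t)>0$ and $q_\infty:=\lim_{t\to\infty}\mathsf q(t)>0$; $\mathsf p(t)\to p_\infty$ as $t\to\infty$; $\mathsf r(t)\ge\mathsf q(t)/4$ for all $t>0$ and $r_\infty>q_\infty/4$; (3) $\gamma_{n+1}/\gamma_n\to1$, $\sum_n\gamma_n=+\infty$ and $\sum_n\gamma_n^2<\infty$; (4) for every compact set $K\subset\mathbb{R}^d$, $\sup_{x\in K}\mathbb{E}_\xi\|\nabla f(x,\xi)\|^4<\infty$; (5) $\nabla F$ is (globally) Lipschitz continuous; (6) there exists $C>0$ such that for all $x\in\mathbb{R}^d$, $\mathbb{E}_\xi[\|\nabla f(x,\xi)\|^2]\le C(1+F(x))$. Then the sequence $(v_n,m_n,x_n)$ given by (ALG) is bounded with probability one.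
   Context: $d\ge1$; $\mathbb{R}_+=[0,\infty)$; $\mathcal Z_+:=\mathbb{R}_+^d\times\mathbb{R}^d\times\mathbb{R}^d$; vector operations (quotients, square roots, powers $x^{\odot\alpha}$, addition of a scalar) are componentwise. Setting: $(\Xi,\mathcal T,\mu)$ is a probability space, $f:\mathbb{R}^d\times\Xi\to\mathbb{R}$ is $\mathcal B(\mathbb{R}^d)\otimes\mathcal T$-measurable, and $\mathbb{E}_\xi\varphi(\xi):=\int\varphi\,d\mu$. $\nabla f(x,s)$ denotes the gradient with respect to $x$. Assumptions on $f$: for every $x$, $f(x,\cdot)$ is $\mu$-integrable; for every $s\in\Xi$, $f(\cdot,s)$ is differentiable; for every $x$, $\nabla f(x,\cdot)^{\odot2}$ is $\mu$-integrable; and there is a measurable $\kappa:\mathbb{R}^d\times\Xi\to\mathbb{R}_+$ such that for every $x\in\mathbb{R}^d$, $\kappa(x,\cdot)$ is $\mu$-integrable and there exists $\varepsilon_x>0$ such that for every $s\in\Xi$ and all $u,v$ in the open ball $B(x,\varepsilon_x)$, $$\max\big(\|\nabla f(u,s)-\nabla f(v,s)\|,\ \|\nabla f(u,s)^{\odot2}-\nabla f(v,s)^{\odot2}\|\big)\le\kappa(x,s)\|u-v\|.$$ Define $F(x)=\mathbb{E}_\xi[f(x,\xi)]$. Then $F$ is differentiable with $\nabla F(x)=\mathbb{E}_\xi[\nabla f(x,\xi)]$. $(\gamma_n)_{n\ge1}$ is a sequence of positive reals, $\tau_n=\sum_{k=1}^n\gamma_k$, and $(\xi_n)_{n\ge1}$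 are i.i.d. $\Xi$-valued random variables with law $\mu$ on a probability space $(\Omega,\mathcal F,\mathbb{P})$. Let $h_0,r_0,p_0,q_0\in(0,\infty)$ and, for $n\ge1$, $h_n=\mathsf h(\tau_n)$, $r_n=\mathsf r(\tau_n)$, $p_n=\mathsf p(\tau_n)$, $q_n=\mathsf q(\tau_n)$. It is assumed throughout that $1-\gamma_{n+1}q_n\ge0$ for all $n\in\mathbb{N}$. Let $\varepsilon>0$. Algorithm (ALG): given $z_0=(v_0,m_0,x_0)\in\mathcal Z_+$, for $n\ge0$, $$v_{n+1}=(1-\gamma_{n+1}q_n)v_n+\gamma_{n+1}p_n\nabla f(x_n,\xi_{n+1})^{\odot2},$$ $$m_{n+1}=(1-\gamma_{n+1}r_n)m_n+\gamma_{n+1}h_n\nabla f(x_n,\xi_{n+1}),\qquad x_{n+1}=x_n-\gamma_{n+1}\frac{m_{n+1}}{\sqrt{v_{n+1}+\varepsilon}}.$$ *)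

(* Defs.v *)
From HB Require Import structures.
From mathcomp Require Export all_boot all_order all_algebra finmap.
From mathcomp Require Export all_classical all_reals all_analysis.
Export Order.TTheory GRing.Theory Num.Theory.
Export numFieldNormedType.Exports.

Set Implicit Arguments.
Unset Strict Implicit.
Unset Printing Implicit Defensive.

Local Open Scope classical_set_scope.
Local Open Scope ring_scope.

(* The library norm on ['rV[R]_d] is the sup norm; [enorm] is the Euclidean
   one. *)
Definition enorm (R : realType) (d : nat) (x : 'rV[R]_d) : R :=
  Num.sqrt (\sum_(j < d) x 0 j ^+ 2).

Definition eball (R : realType) (d : nat) (x : 'rV[R]_d) (e : R) :
  set 'rV[R]_d := [set y | enorm (y - x) < e].

Definition grad (R : realType) (d : nat) (g : 'rV[R]_d -> R) (x : 'rV[R]_d) :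
  'rV[R]_d := \row_(j < d) 'D_(delta_mx 0 j) g x.

Definition hpow (R : realType) (d : nat) (x : 'rV[R]_d) (k : nat) : 'rV[R]_d :=
  \row_(j < d) (x 0 j ^+ k).

(* R^d with its Borel sigma-algebra (the library only provides one on R). *)
Notation borel_rV R d := (g_sigma_algebraType (@open 'rV[R]_d)).

Definition mutually_independent (dO dX : measure_display)
    (Omega : measurableType dO) (Xi : measurableType dX) (R : realType)
    (P : probability Omega R) (I : choiceType) (X : I -> {RV P >-> Xi}) :=
  forall (J : {fset I}) (A : I -> set Xi), (forall i, measurable (A i)) ->
    P (\bigcap_(i in [set` J]) X i @^-1` A i)
    = (\prod_(i <- J) P (X i @^-1` A i))%E.

Definition tau (R : realType) (gamma : nat -> R) (n : nat) : R :=
  \sum_(1 <= k < n.+1) gamma k.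

(* From the initial value [c0] and the function [c], the sequence with
   [c_0 = c0] and [c_n = c (tau_n)] for [n >= 1]. *)
Definition coef (R : realType) (gamma : nat -> R) (c0 : R) (c : R -> R)
  (n : nat) : R := if n is 0 then c0 else c (tau gamma n).

(* One step [z_n -> z_(n+1)]; [ga] is [gamma_(n+1)], [s] is [xi_(n+1)], and
   [h], [r], [p], [q] are the coefficients with index [n]. *)
Definition alg_step (R : realType) (d : nat) (Xi : Type)
    (f : 'rV[R]_d -> Xi -> R) (eps ga h r p q : R) (s : Xi)
    (z : 'rV[R]_d * 'rV[R]_d * 'rV[R]_d) : 'rV[R]_d * 'rV[R]_d * 'rV[R]_d :=
  let: (v, m, x) := z in
  let g := grad (f ^~ s) x in
  let v' := (1 - ga * q) *: v + (ga * p) *: hpow g 2 in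
  let m' := (1 - ga * r) *: m + (ga * h) *: g in
  let x' := x - ga *: \row_(j < d) (m' 0 j / Num.sqrt (v' 0 j + eps)) in
  (v', m', x').

(* [gamma 0] and [xs 0] are never used. *)
Fixpoint alg (R : realType) (d : nat) (Xi : Type)
    (f : 'rV[R]_d -> Xi -> R) (eps : R) (gamma h r p q : nat -> R)
    (xs : nat -> Xi) (z0 : 'rV[R]_d * 'rV[R]_d * 'rV[R]_d) (n : nat) :
    'rV[R]_d * 'rV[R]_d * 'rV[R]_d :=
  if n is k.+1 then
    alg_step f eps (gamma k.+1) (h k) (r k) (p k) (q k) (xs k.+1)
      (alg f eps gamma h r p q xs z0 k)
  else z0.

(* Main.v *)
(* Let [D] be the vector [1 / sqrt (v + eps)] and [E_n = h_n (1 + F x_n) +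
   1/2 <m_n^2, D_n>], which is nonnegative since (6) gives [1 + F >= 0]. In
   [E_(n+1)] the cross term [- ga h <grad F x_n, m_(n+1) D_(n+1)>] of the
   descent inequality completes the square [1/2 <m_(n+1)^2, D_(n+1)>] up to a
   nonpositive term, and the square can then be bounded with the factor
   [((1 - ga q) v_n + eps)^(-1/2) >= D_(n+1)], which does not depend on the new
   sample. Hence the expectation of [E_(n+1)] given the past is at most
   [(1 + A ga^2) E_n]: the linear terms in [ga] have the good sign because
   [r >= q / 4]. As [sum ga^2] is finite, the maximal inequality for nonnegative
   supermartingales makes [E_n], hence [x_n] by coercivity, almost surely
   bounded. On the event that [x_n] stays in a ball, the fourth moments give
   the same inequality for [1 + ((v_n - c)^+)^2] with [c] a large constant, so
   [v_n] is bounded, and then so is [m_n] by the bound on [E_n]. *)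

(* Conditional expectations never appear. The sigma-algebra of the first [n] samples is put on
   [Omega] itself, the identity serves as the random past, and independence with Tonelli integrates
   out the next sample while the state stays fixed; a drift inequality is then a statement about one
   fixed state. The price is measurability with respect to the history, hence the work on Borel
   measurability of gradients and of [F]. The drift inequalities are available only from some index
   [n0] on: the coefficients of index 0 are arbitrary, so monotonicity starts at index 1, the
   damping estimate wants small steps, and [p] is controlled only near its limit. The value at [n0]
   is truncated instead of being shown integrable. For [v] the moment bounds, and with them [c] and
   the rate, depend on the ball. The process is killed when [x] leaves it, and countably many balls
   suffice because each trajectory has its own bound. The formula for the gradient of [F] comes from
   integrating a quadratic Taylor remainder. *)
From HB Require Import structures.
Require Import Defs.
From mathcomp Require Import measurable_realfun.
From mathcomp Require Import ring lra.

Set Implicit Arguments.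
Unset Strict Implicit.
Unset Printing Implicit Defensive.

Local Open Scope classical_set_scope.
Local Open Scope ring_scope.

(** * Nonnegative supermartingales *)

Section supermartingale.
Context {dO : measure_display} {Omega : measurableType dO} {R : realType}.
Variables (P : probability Omega R) (G : nat -> set (set Omega)).
Hypothesis G_sigma : forall n, sigma_algebra setT (G n).
Hypothesis G_meas : forall n A, G n A -> measurable A.
Hypothesis G_incr : forall n, G n `<=` G n.+1.

Lemma filtrationC n A : G n A -> G n (~` A).
Proof. by have [_ GC _] := G_sigma n; move=> /GC; rewrite setTD. Qed.

Lemma filtrationI n A B : G n A -> G n B -> G n (A `&` B).
Proof.
have [_ _ GU] := G_sigma n.
move=> GA GB; rewrite -[A `&` B]setCK setCI; apply: filtrationC.
rewrite -bigcup2E; apply: GU => -[|[|i]]; rewrite /bigcup2 /=; try exact: filtrationC.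
by have [] := G_sigma n.
Qed.

Lemma adapted_measurable n (X : Omega -> R) D :
  (forall a, G n [set w | X w < a]) -> measurable_fun D (EFin \o X).
Proof.
move=> adX.
suff: measurable_fun [set: Omega] (X).
  by move=> h; apply/measurable_funTS/measurable_EFinP.
apply: (measurability _ (RGenOInfty.measurableE R)) => _ [_ [a ->] <-].
rewrite setTI.
(* Only strict sublevel sets are known to be measurable, so the open ray is approached from inside
   by the levels [a + 1/(k+1)]. *)
have -> : X @^-1` `]a, +oo[ = \bigcup_k ~` [set w | X w < a + k.+1%:R^-1].
  apply/seteqP; split => w /=.
    rewrite in_itv/= andbT => ltX; have [k ka] := ltr_add_invr ltX.
    by exists k => //=; apply/negP; rewrite -leNgt ltW.
  move=> [k _ /= /negP]; rewrite -leNgt in_itv/= andbT; apply: lt_le_trans.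
  by rewrite ltrDl invr_gt0.
by apply: bigcupT_measurable => k; exact/measurableC/G_meas/adX.
Qed.

Section maximal.
Variable X : nat -> Omega -> R.
Hypothesis X_ge0 : forall n w, 0 <= X n w.
Hypothesis X_adapted : forall n a, G n [set w | X n w < a].
(* Integrating over the events of the filtration replaces conditional
   expectations. *)
Hypothesis X_super : forall n A, G n A ->
  (\int[P]_(w in A) (X n.+1 w)%:E <= \int[P]_(w in A) (X n w)%:E)%E.

Let mX n D : measurable_fun D (EFin \o X n).
Proof. by apply: adapted_measurable => a; exact: X_adapted. Qed.

(** In terms of the first time [T] at which the level [a] is reached, this is the event [T > n]; it
    replaces a stopping time. *)
Let below (a : R) n := \bigcap_(k < n.+1) [set w | X k w < a].

Let belowS a n : below a n.+1 = below a n `&` [set w | X n.+1 w < a].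
Proof.
apply/seteqP; split => w /=.
  by move=> h; split => [k kn|]; apply: h => //=; rewrite ltnS ltnW.
by move=> [h hn] k /=; rewrite ltnS leq_eqVlt => /orP[/eqP -> //|kn]; exact: h.
Qed.

Let G_below a n : G n (below a n).
Proof.
elim: n => [|n IH].
  suff -> : below a 0 = [set w | X 0 w < a] by exact: X_adapted.
  apply/seteqP; split => w /=; first by move=> /(_ 0); exact.
  by move=> h [|//] _.
by rewrite belowS; apply: filtrationI; [exact/G_incr|exact: X_adapted].
Qed.

(** Optional stopping by induction: the left-hand side does not increase with [n]. The
    supermartingale property is used on [below a n], and the paths that reach [a] at time [n+1] then
    pay at least [a] each. *)
Let maximal_step (a : R) n : 0 < a ->
  (a%:E * P (~` below a n) + \int[P]_(w in below a n) (X n w)%:E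
   <= \int[P]_w (X 0 w)%:E)%E.
Proof.
move=> a0.
have mb m : measurable (below a m) by exact/G_meas/G_below.
have mXa m : measurable [set w | X m w < a] by exact/G_meas/X_adapted.
(* Markov's inequality on the part of [D] where [X m] is at least [a], the integral over the rest
   being kept. *)
have split_int m (D : set Omega) : measurable D ->
    (a%:E * P (D `\` [set w | (X m w < a)%R]) +
     \int[P]_(w in D `&` [set w | (X m w < a)%R]) (X m w)%:E <=
     \int[P]_(w in D) (X m w)%:E)%E.
  move=> mD.
  have mDa : measurable (D `\` [set w | X m w < a]) by exact: measurableD.
  have mIa : measurable (D `&` [set w | X m w < a]) by exact: measurableI.
  rewrite -[in leRHS](setUIDK D [set w | X m w < a]) setUC.
  rewrite ge0_integral_setU//=; first last.
    - by apply/disj_setPS => w /= [[_ ?] [_ ?]].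
    - by move=> w _; rewrite lee_fin.
    - exact: mX.
  apply: leeD2r; rewrite -integral_cst//; apply: ge0_le_integral => //.
  - by move=> w _; rewrite lee_fin ltW.
  - exact: mX.
  - by move=> w /= [_ /negP]; rewrite lee_fin -leNgt.
elim: n => [|n IH].
  have -> : below a 0 = setT `&` [set w | X 0 w < a].
    apply/seteqP; split => w /=; first by move=> /(_ 0) h; split => //; exact: h.
    by move=> [_ h] [|//] _.
  by rewrite -setTD setDIr setDv set0U; exact: split_int.
apply: le_trans IH; rewrite belowS.
have -> : ~` (below a n `&` [set w | X n.+1 w < a]) =
    ~` below a n `|` (below a n `\` [set w | X n.+1 w < a]).
  apply/seteqP; split => w /=.
    move=> h; have [bw|nbw] := pselect (below a n w); last by left.
    by right; split => // hX; exact: h.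
  by move=> [h|[_ h]] [].
rewrite measureU//; first last.
- by apply/seteqP; split => w //= [? []].
- exact: measurableD.
- exact: measurableC.
rewrite ge0_muleDr// -addeA; apply: leeD2l.
by apply: (le_trans _ (X_super (G_below a n))); exact: split_int.
Qed.

(** The complements of [below a n] increase to the event of ever reaching [a]; continuity from below
    gives the limit once the remaining nonnegative integral is dropped. *)
Lemma maximal_ineq (a : R) : 0 < a ->
  (a%:E * P (\bigcup_n [set w | (a <= X n w)%R]) <= \int[P]_w (X 0 w)%:E)%E.
Proof.
move=> a0.
have mb m : measurable (~` below a m) by exact/measurableC/G_meas/G_below.
have -> : \bigcup_n [set w | (a <= X n w)%R] = \bigcup_n ~` below a n.
  apply/seteqP; split => w /= [n _ /=].
    by move=> aX; exists n => //= /(_ n (ltnSn _)) /=; rewrite ltNge aX.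
  by move=> /existsNP[k /not_implyP[_ /negP]]; rewrite -leNgt; exists k.
have nd : {homo (fun n => ~` below a n) : n m / (n <= m)%N >-> (n <= m)%O}.
  move=> n m nm; apply/subsetPset/subsetC => w /= h k /= kn; apply: h => /=.
  exact: leq_trans kn _.
rewrite -lee_pdivlMl//.
have cv : (P \o (fun n => ~` below a n)) n @[n --> \oo] --> P (\bigcup_n ~` below a n).
  exact: nondecreasing_cvg_mu (bigcupT_measurable _ mb) nd.
rewrite -(cvg_lim _ cv)//; apply: lime_le; first exact: cvgP cv.
apply: nearW => n /=; rewrite lee_pdivlMl//.
by apply: le_trans (maximal_step n a0); rewrite leeDl// integral_ge0// => w _; rewrite lee_fin.
Qed.

Lemma supermartingale_ae_bounded : (\int[P]_w (X 0 w)%:E < +oo)%E ->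
  {ae P, forall w, exists M, forall n, X n w <= M}.
Proof.
move=> X0oo.
pose B k := \bigcup_n [set w | k.+1%:R <= X n w].
have mB k : measurable (B k).
  apply: bigcupT_measurable => n.
  rewrite (_ : [set _ | _] = ~` [set w | X n w < k.+1%:R]).
    exact/measurableC/G_meas/X_adapted.
  by apply/seteqP; split => w /=; rewrite leNgt => /negP.
exists (\bigcap_k B k); split.
- exact: bigcapT_measurable.
- have I0 : (0 <= \int[P]_w (X 0 w)%:E)%E by apply: integral_ge0 => w _; rewrite lee_fin.
  have Ifin : (\int[P]_w (X 0 w)%:E)%E \is a fin_num by rewrite ge0_fin_numE.
  set I := (\int[P]_w _)%E in X0oo I0 Ifin.
  apply/eqP; rewrite eq_le measure_ge0 andbT; apply/lee_addgt0Pr => e e0.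
  rewrite add0e.
  (* An unbounded path lies in every [B k], whose probability is at most [I / (k+1)]; this [k] makes
     that at most [e]. *)
  pose k := Num.truncn (fine I / e).
  apply: (@le_trans _ _ (P (B k))).
    by apply: le_measure; rewrite ?inE//; [exact: bigcapT_measurable|exact: bigcap_inf].
  have := @maximal_ineq k.+1%:R (ltr0Sn _ _); rewrite -/(B k) -lee_pdivlMl//.
  move=> h; apply: le_trans h _; rewrite -/I -(fineK Ifin) -EFinM lee_fin.
  rewrite ler_pdivrMl// mulrC -ler_pdivrMl// mulrC.
  by apply: ltW; exact: truncnS_gt.
- move=> w /= h k _; apply: contrapT => nB; apply: h; exists k.+1%:R => n.
  by rewrite leNgt; apply/negP => kX; apply: nB; exists n => //=; exact: ltW.
Qed.

End maximal.

Lemma almost_supermartingale_ae_bounded (Y : nat -> Omega -> R)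
    (E : nat -> set Omega) (a : nat -> R) (b : R) :
  (forall n w, 0 <= Y n w) -> (forall n c, G n [set w | Y n w < c]) ->
  (forall n, G n (E n)) -> (forall n, 1 <= a n) ->
  (forall n, \prod_(k < n) a k <= b) ->
  (forall n A, G n A -> A `<=` E n ->
    (\int[P]_(w in A) (Y n.+1 w)%:E <= (a n)%:E * \int[P]_(w in A) (Y n w)%:E)%E) ->
  {ae P, forall w, (forall n, E n w) -> exists M, forall n, Y n w <= M}.
Proof.
move=> Y0 aY GE a1 ab Ysuper.
(* The maximal inequality applies to [Y] normalised by the products of the
   [a k], killed outside the events [E] and truncated at time [0]. *)
pose p n := \prod_(k < n) a k.
have p_gt0 n : 0 < p n by apply: prodr_gt0 => k _; exact: lt_le_trans (a1 k).
have pS n : p n.+1 = p n * a n by rewrite /p big_ord_recr.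
pose S (K : nat) n := [set w | Y 0 w < K%:R] `&` \bigcap_(k < n.+1) E k.
have SS K n : S K n.+1 = S K n `&` E n.+1.
  apply/seteqP; split => w /=.
    move=> [YK h]; split; last by apply: h => /=.
    by split => // k /= kn; apply: h => /=; rewrite ltnS ltnW.
  move=> [[YK h] h']; split => // k /=; rewrite ltnS leq_eqVlt => /orP[/eqP -> //|kn].
  exact: h.
have GS K n : G n (S K n).
  elim: n => [|n IH]; last by rewrite SS; apply: filtrationI => //; exact: G_incr.
  apply: filtrationI; first exact: aY.
  rewrite (_ : \bigcap_(_ < _) _ = E 0)//; apply/seteqP; split => w /=.
    by move=> /(_ 0); exact.
  by move=> h [|//] _.
pose X K n := (fun w => (p n)^-1 * Y n w) \_ (S K n).
have X0 K n w : 0 <= X K n w.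
  by rewrite /X patchE; case: ifP => // _; rewrite mulr_ge0// invr_ge0 ltW.
have XE K n A : (\int[P]_(w in A) (X K n w)%:E =
    \int[P]_(w in A `&` S K n) ((p n)^-1%:E * (Y n w)%:E))%E.
  rewrite integral_mkcondr; apply: eq_integral => w _.
  by rewrite /X !patchE; case: ifP.
have mY n D : measurable_fun D (EFin \o Y n).
  by apply: adapted_measurable => c; exact: aY.
have aX K n c : G n [set w | X K n w < c].
  have [c0|c0] := ltP 0 c; last first.
    rewrite (_ : [set _ | _] = set0); first by have [] := G_sigma n.
    by rewrite -subset0 => w /=; rewrite ltNge (le_trans c0)//.
  rewrite (_ : [set _ | _] = ~` (S K n `&` ~` [set w | Y n w < p n * c])).
    by apply: filtrationC; apply: filtrationI => //; exact/filtrationC/aY.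
  apply/seteqP; split => w /=; rewrite /X patchE.
    case: ifPn => [|/negP]; rewrite inE => Sw; last by move=> _ [].
    by rewrite ltr_pdivrMl// => h [].
  case: ifPn => // /set_mem Sw /not_andP[//|/contrapT].
  by rewrite ltr_pdivrMl//.
have Xsuper K n A : G n A ->
    (\int[P]_(w in A) (X K n.+1 w)%:E <= \int[P]_(w in A) (X K n w)%:E)%E.
  move=> GA; rewrite !XE.
  have GAS : G n (A `&` S K n) by exact: filtrationI.
  have pos m w : (0 <= (p m)^-1%:E * (Y m w)%:E)%E.
    by rewrite -EFinM lee_fin mulr_ge0// invr_ge0 ltW.
  (* Killing on the smaller event [S K n.+1] can only lower the integral of a nonnegative
     function. *)
  apply: (@le_trans _ _ (\int[P]_(w in A `&` S K n) ((p n.+1)^-1%:E * (Y n.+1 w)%:E))%E).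
    apply: ge0_subset_integral => //.
    - by apply: measurableI; apply: G_meas; [exact: GA|exact: GS].
    - exact: G_meas GAS.
    - by apply: measurable_funeM; exact: mY.
    - by rewrite SS => w [? []].
  rewrite !ge0_integralZl_EFin//; first last.
  - by rewrite invr_ge0 ltW.
  - exact: mY.
  - by move=> w _; rewrite lee_fin.
  - exact: G_meas GAS.
  - by rewrite invr_ge0 ltW.
  - exact: mY.
  - by move=> w _; rewrite lee_fin.
  - exact: G_meas GAS.
  rewrite lee_pdivrMl// muleA -EFinM pS.
  rewrite mulrAC mulfV ?gt_eqF// mul1r; apply: Ysuper => //.
  by move=> w /= [_ [_ h]]; apply: h => /=.
have Xoo K : (\int[P]_w (X K 0 w)%:E < +oo)%E.
  apply: (@le_lt_trans _ _ (\int[P]_w (cst K%:R%:E) w)%E).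
    apply: ge0_le_integral => //.
    - by move=> w _; rewrite lee_fin.
    - by apply: adapted_measurable => c; exact: aX.
    - move=> w _; rewrite lee_fin /X patchE; case: ifP => //.
      by rewrite inE /p big_ord0 invr1 mul1r => -[/ltW].
  by rewrite integral_cst//; have := probability_setT P => /= ->; rewrite mule1 ltry.
have /ae_foralln := fun K => supermartingale_ae_bounded (X0 K) (aX K) (Xsuper K) (Xoo K).
apply: filterS => w bw Ew.
(* The truncation level is taken above [Y 0 w], so this path is never killed and its normalised
   values are those of [Y]. *)
have [M XM] := bw (Num.truncn (Y 0 w)).+1.
exists (b * `|M|) => n.
have Sw : S (Num.truncn (Y 0 w)).+1 n w.
  by split => [/=|k _]; [exact: truncnS_gt|exact: Ew].
have := XM n; rewrite /X patchE mem_set//.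
rewrite ler_pdivrMl// => /le_trans; apply.
apply: (@le_trans _ _ (p n * `|M|)); first by rewrite ler_pM2l// ler_norm.
by rewrite ler_wpM2r// ab.
Qed.

End supermartingale.

(** * Integration over an independent sample *)

(** Independence identifies the law of the pair with the product measure on rectangles, hence
    everywhere; Tonelli does the rest. *)
Lemma ge0_integral_indep {dO dT dX : measure_display}
    {Omega : measurableType dO} {T : measurableType dT} {Xi : measurableType dX}
    {R : realType} (P : probability Omega R) (mu : probability Xi R)
    (Z : {mfun Omega >-> T}) (X : {mfun Omega >-> Xi}) (psi : T * Xi -> \bar R) :
  (forall A B, measurable A -> measurable B ->
    P (Z @^-1` A `&` X @^-1` B) = (P (Z @^-1` A) * mu B)%E) ->
  measurable_fun setT psi -> (forall u, 0 <= psi u)%E ->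
  (\int[P]_w psi (Z w, X w) = \int[P]_w \int[mu]_s psi (Z w, s))%E.
Proof.
move=> indep mpsi psi0.
have mZX : measurable_fun setT (fun w => (Z w, X w)) by exact: measurable_fun_pair.
pose ZX : {mfun Omega >-> (T * Xi)%type} := HB.pack (fun w => (Z w, X w))
  (isMeasurableFun.Build _ _ _ _ _ mZX).
have joint A : measurable A -> (distribution P Z \x mu)%E A = distribution P ZX A.
  by apply: product_measure_unique => B C mB mC; rewrite -indep.
transitivity (\int[distribution P ZX]_u psi u)%E.
  by rewrite ge0_integral_distribution.
transitivity (\int[(distribution P Z \x mu)%E]_u psi u)%E.
  by apply: eq_measure_integral => A mA _; exact: (esym (joint A mA)).
rewrite fubini_tonelli1// ge0_integral_distribution//.
- exact: measurable_fun_fubini_tonelli_F.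
- by move=> t; exact: integral_ge0.
Qed.

Section history.
Context {dO dX : measure_display} {Omega : measurableType dO}
  {Xi : measurableType dX} {R : realType}.
Variables (P : probability Omega R) (mu : probability Xi R).
Variable X : nat -> {RV P >-> Xi}.
Hypothesis X_law : forall n A, measurable A -> P (X n @^-1` A) = mu A.
Hypothesis X_indep : mutually_independent X.

(** A pi-system generating the sigma-algebra of [X 0], ..., [X (n-1)]. The strict bound makes [X n]
    the first sample that the history [n] does not know. *)
Definition cylinder n : set (set Omega) :=
  [set \bigcap_(i < n) X i @^-1` A i | A in [set A | forall i, measurable (A i)]].

Lemma cylinder_measurable n : cylinder n `<=` measurable.
Proof.
move=> _ [A mA <-]; apply: bigcap_measurableType => i _.
by rewrite -[_ @^-1` _]setTI; exact: measurable_funP.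
Qed.

Lemma setI_closed_cylinder n : setI_closed (cylinder n).
Proof.
move=> _ _ [A mA <-] [B mB <-]; exists (fun i => A i `&` B i) => /=.
  by move=> i; exact: measurableI.
by rewrite -bigcapI; apply: eq_bigcapr => i _; rewrite preimage_setI.
Qed.

Lemma sub_cylinderS n : cylinder n `<=` cylinder n.+1.
Proof.
move=> _ [A mA <-]; exists (fun i => if (i < n)%N then A i else setT) => /=.
  by move=> i; case: ifP.
apply/seteqP; split => w /= h i /=.
  by move=> iltn; have := h i; rewrite /= iltn ltnS ltnW//; exact.
by case: ifP => // iltn _; exact: h.
Qed.

Lemma history_measurable n A : <<s cylinder n >> A -> measurable A.
Proof.
move: A; apply: smallest_sub; first exact: sigma_algebra_measurable.
exact: cylinder_measurable.
Qed.

Lemma sub_historyS n : <<s cylinder n >> `<=` <<s cylinder n.+1 >>.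
Proof. apply: sub_sigma_algebra2; exact: sub_cylinderS. Qed.

Lemma measurable_history n :
  measurable_fun setT (X n : g_sigma_algebraType (cylinder n.+1) -> Xi).
Proof.
move=> _ B mB; rewrite setTI; apply: sub_sigma_algebra.
exists (fun i => if i == n then B else setT); first by move=> i /=; case: ifP.
apply/seteqP; split => w /=; first by move=> /(_ n (ltnSn n)) /=; rewrite eqxx.
by move=> Bw i /= _; case: ifPn => // /eqP ->.
Qed.

Lemma measurable_id_history n :
  measurable_fun setT (id : Omega -> g_sigma_algebraType (cylinder n)).
Proof. by move=> _ A; rewrite setTI; exact: history_measurable. Qed.

Lemma measurable_history_step n : measurable_fun setT
  (fun w : g_sigma_algebraType (cylinder n.+1) =>
     ((w, X n w) : g_sigma_algebraType (cylinder n) * Xi)%type).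
Proof.
apply: measurable_fun_pair; last exact: measurable_history.
by move=> _ A; rewrite setTI; exact: sub_historyS.
Qed.

Lemma cylinder_prob n (A : nat -> set Xi) : (forall i, measurable (A i)) ->
  P (\bigcap_(i < n) X i @^-1` A i) = (\prod_(i <- iota 0 n) P (X i @^-1` A i))%E.
Proof.
move=> mA; pose J := [fset i in iota 0 n]%fset.
have Jn : perm_eq J (iota 0 n).
  by apply: uniq_perm; rewrite ?iota_uniq// => i; rewrite inE.
rewrite -(perm_big _ Jn) -(X_indep J mA); congr (P _).
apply: eq_bigcapl; split => i /=; rewrite !inE mem_iota//= add0n.
Qed.

(** Dynkin's pi-lambda argument: the events [A] satisfying the product formula form a Dynkin system
    that contains the cylinders. *)
Lemma history_indep n A B : <<s cylinder n >> A -> measurable B ->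
  P (A `&` X n @^-1` B) = (P A * mu B)%E.
Proof.
move=> cA mB.
have mXB : measurable (X n @^-1` B).
  by rewrite -[_ @^-1` _]setTI; exact: measurable_funP.
pose T := g_sigma_algebraType (cylinder n).
have mT (S : set T) : measurable S -> measurable (S : set Omega).
  exact: history_measurable.
move: A cA; apply: (@dynkin_induction _ T (cylinder n)
    [set A | P (A `&` X n @^-1` B) = (P A * mu B)%E]) => //.
- exact: setI_closed_cylinder.
- by rewrite /= setTI X_law//; have := probability_setT P => /= ->; rewrite mul1e.
- move=> _ [A mA <-] /=.
  (* Placing [B] at coordinate [n] turns the intersection into a cylinder of length [n+1], to which
     mutual independence applies. *)
  pose A' i := if (i < n)%N then A i else B.
  have mA' i : measurable (A' i) by rewrite /A'; case: ifP.
  have -> : \bigcap_(i < n) X i @^-1` A i `&` X n @^-1` B =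
      \bigcap_(i < n.+1) X i @^-1` A' i.
    apply/seteqP; split => w /=.
      move=> [h Bw] i; rewrite /A' /= ltnS leq_eqVlt => /orP[/eqP ->|iltn].
        by rewrite ltnn.
      by rewrite iltn; exact: h.
    move=> h; split; last by have := h n (ltnSn n); rewrite /A' ltnn.
    by move=> i /= iltn; have := h i; rewrite /= /A' iltn ltnS ltnW//; exact.
  rewrite !cylinder_prob// -addn1 iotaD big_cat/= big_seq1 add0n.
  rewrite /A' ltnn X_law//; congr (_ * _)%E.
  by apply: eq_big_seq => i; rewrite mem_iota /= add0n => ->.
- move=> S /mT mS /= IH.
  have PT : P setT = 1%E by exact: probability_setT.
  rewrite setIC -setDE measureD//; last first.
    by rewrite (le_lt_trans (probability_le1 P mXB))// ltry.
  transitivity (mu B - P S * mu B)%E.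
    by congr (_ - _)%E; [exact: X_law|rewrite setIC; exact: IH].
  rewrite probability_setC// muleBl; first by rewrite mul1e.
  - exact: fin_num_measure.
  - by apply: fin_num_adde_defr; rewrite fin_numE.
- move=> F mF tF IH /=.
  have mF' i : measurable (F i : set Omega) by exact: mT.
  rewrite setI_bigcupl !measure_bigcup//=; last 2 first.
  - by move=> i _; exact: measurableI.
  - by apply: trivIset_setIr.
  rewrite (eq_eseriesr (fun i _ => IH i)).
  rewrite -(fineK (fin_num_measure mu B mB)) muleC -nneseriesZl//.
  by apply: eq_eseriesr => i _; rewrite muleC.
Qed.

(** The form in which conditioning on the past is used. The random past is the identity of [Omega],
    read as a map into the coarser sigma-algebra. *)
Lemma ge0_integral_history n (B : set Omega)
    (psi : g_sigma_algebraType (cylinder n) * Xi -> \bar R) :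
  <<s cylinder n >> B ->
  measurable_fun setT psi -> (forall u, 0 <= psi u)%E ->
  (\int[P]_(w in B) psi (w, X n w) = \int[P]_(w in B) \int[mu]_s psi (w, s))%E.
Proof.
move=> HB mpsi psi0.
pose T := g_sigma_algebraType (cylinder n).
pose Z : {mfun Omega >-> T} := HB.pack (id : Omega -> T)
  (isMeasurableFun.Build _ _ _ _ _ (@measurable_id_history n)).
have mBT : measurable ((B : set T) `*` [set: Xi]) by exact: measurableX.
transitivity (\int[P]_w (psi \_ (B `*` setT)) (Z w, X n w))%E.
  rewrite integral_mkcond; apply: eq_integral => w _; rewrite !patchE.
  by rewrite in_setX in_setT andbT.
rewrite (@ge0_integral_indep _ _ _ _ _ _ _ P mu).
- rewrite [RHS]integral_mkcond; apply: eq_integral => w _; rewrite patchE.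
  case: ifPn => wB.
    by apply: eq_integral => s _; rewrite patchE in_setX in_setT andbT wB.
  rewrite integral0_eq// => s _.
  by rewrite patchE in_setX in_setT andbT (negbTE wB).
- by move=> C D mC mD; exact: history_indep.
- by apply/(measurable_restrictT _ _).1 => //; exact: measurable_funTS.
- by move=> u; rewrite patchE; case: ifP.
Qed.

End history.

(** * Borel measurability and gradients *)

Section borel_rV.
Context {R : realType} {d : nat}.

(** An open set is a countable union of boxes with rational centre and radius [1/(k+1)], and the
    preimage of a box is a finite intersection of conditions on the coordinates. *)
Lemma measurable_fun_rV {dT : measure_display} {T : measurableType dT}
    (X : T -> 'rV[R]_d) :
  (forall j, measurable_fun setT (fun t => X t 0 j)) ->
  measurable_fun setT (X : T -> borel_rV R d).
Proof.
move=> mX.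
apply: (@measurability _ _ _ (borel_rV R d) setT X (@open (matrix R 1 d))) => //.
move=> _ [U oU <-].
rewrite setTI.
pose box (c : 'rV[rat]_d * nat) : set 'rV[R]_d :=
  [set y | forall j, `|y 0 j - ratr (c.1 0 j)| < c.2.+1%:R^-1].
have -> : X @^-1` U =
    \bigcup_(c : 'rV[rat]_d * nat) (if `[< box c `<=` U >] then X @^-1` box c else set0).
  apply/seteqP; split => t /=; last first.
    by move=> [c _]; case: asboolP => // cU /cU.
  move=> Ut; have /nbhs_ballP[e /= e0 eU] : nbhs (X t) U by exact: open_nbhs_nbhs.
  (* Two radii [1/(k+1)] must fit into [e]: one from the point to the rational centre, one from the
     centre to the rest of the box. *)
  pose k := Num.truncn (2 / e).
  have k0 : 0 < k.+1%:R^-1 :> R by rewrite invr_gt0.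
  have ke : k.+1%:R^-1 + k.+1%:R^-1 <= e.
    rewrite -mulr2n -(mulr_natr k.+1%:R^-1 2) ler_pdivrMl// -ler_pdivrMr//.
    by apply: ltW; exact: truncnS_gt.
  have /choice[c cP] : forall j : 'I_d, exists q : rat,
      `|X t 0 j - ratr q| < k.+1%:R^-1.
    move=> j; have [|q] := @rat_in_itvoo R (X t 0 j) (X t 0 j + k.+1%:R^-1).
      by rewrite ltrDl.
    rewrite in_itv/= => /andP[q1 q2]; exists q.
    by rewrite distrC ger0_norm ?subr_ge0 ?ltW// ltrBlDl.
  exists (\row_j c j, k) => //; case: asboolP => [_ /= j|[]]; first by rewrite mxE.
  move=> y yc; apply: eU; split => // i j; rewrite (ord1 i).
  suff : `|X t 0 j - y 0 j| < e by [].
  rewrite -[X t 0 j](subrK (ratr (c j))) -addrA.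
  apply: le_lt_trans (ler_normD _ _) _; apply: lt_le_trans ke; apply: ltrD => //.
  by rewrite distrC; have := yc j; rewrite /= mxE.
apply: countable_bigcupT_measurable; first exact: countableP.
move=> c; case: asboolP => // _.
have -> : X @^-1` box c =
    \bigcap_(j in [set: 'I_d]) [set t | `|X t 0 j - ratr (c.1 0 j)| < c.2.+1%:R^-1].
  by apply/seteqP; split => t /= h j => [_|]; exact: h.
apply: fin_bigcap_measurable => [|j _]; first exact: finite_finset.
have mg : measurable_fun setT (fun t => `|X t 0 j - ratr (c.1 0 j)|).
  by apply: measurableT_comp => //; exact: measurable_funB.
rewrite -[[set _ | _]]setTI.
have := mg measurableT [set` `]-oo, (c.2.+1%:R^-1 : R)[] (measurable_itv _).
rewrite !setTI; congr (measurable _); apply/seteqP; split => t /=;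
  by rewrite in_itv.
Qed.

Section measurable_grad.
Context {dX dT : measure_display} {Xi : measurableType dX} {T : measurableType dT}.
Variable f : 'rV[R]_d -> Xi -> R.
Hypothesis f_meas : measurable_fun setT (fun u : borel_rV R d * Xi => f u.1 u.2).
Hypothesis f_diff : forall s x, differentiable (f ^~ s) x.

Lemma measurable_fun_param (X : T -> 'rV[R]_d) (S : T -> Xi) :
  (forall j, measurable_fun setT (fun t => X t 0 j)) -> measurable_fun setT S ->
  measurable_fun setT (fun t => f (X t) (S t)).
Proof.
move=> mX mS.
apply: (@measurableT_comp _ _ _ _ _ _ _ _ (fun t => (X t : borel_rV R d, S t)) f_meas).
by apply: measurable_fun_pair => //; exact: measurable_fun_rV.
Qed.

(** A partial derivative is the pointwise limit of the difference quotients along [1/(n+1)], each of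
    which is jointly measurable. *)
Lemma measurable_grad_param (X : T -> 'rV[R]_d) (S : T -> Xi) j :
  (forall j, measurable_fun setT (fun t => X t 0 j)) -> measurable_fun setT S ->
  measurable_fun setT (fun t => grad (f ^~ (S t)) (X t) 0 j).
Proof.
move=> mX mS; rewrite /grad.
under eq_fun do rewrite mxE.
pose u (n : nat) : R := n.+1%:R^-1.
apply: (@measurable_fun_cvg _ _ _ _ (fun n t =>
   (u n)^-1 * (f (u n *: delta_mx 0 j + X t) (S t) - f (X t) (S t)))).
  move=> n; apply: measurable_funM => //; apply: measurable_funB.
    apply: measurable_fun_param => // i.
    under eq_fun do rewrite !mxE.
    by apply: measurable_funD => //; exact: mX.
  exact: measurable_fun_param.
move=> t _.
have : derivable (f ^~ (S t)) (X t) (delta_mx 0 j) by exact: diff_derivable.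
move=> /cvgr_dnbhsP; apply; split; last exact: cvg_harmonic.
by move=> n; rewrite gt_eqF// invr_gt0.
Qed.

End measurable_grad.
End borel_rV.

(** * Euclidean estimates and first-order expansions *)

Section euclidean.
Context {R : realType} {d : nat}.
Implicit Types (x y v : 'rV[R]_d).

Definition dot x y : R := \sum_(j < d) x 0 j * y 0 j.

Lemma dotBl x y v : dot (x - y) v = dot x v - dot y v.
Proof.
by rewrite /dot -sumrB; apply: eq_bigr => j _; rewrite !mxE mulrBl.
Qed.

Lemma dotZr (a : R) x y : dot x (a *: y) = a * dot x y.
Proof.
by rewrite /dot mulr_sumr; apply: eq_bigr => j _; rewrite !mxE mulrCA.
Qed.

Lemma dot_delta x j : dot x (delta_mx 0 j) = x 0 j.
Proof.
rewrite /dot (bigD1 j)//= big1 ?addr0 => [|i ij]; first by rewrite mxE !eqxx mulr1.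
by rewrite mxE (negbTE ij) andbF mulr0.
Qed.

Lemma enorm_ge0 x : 0 <= enorm x.
Proof. exact: sqrtr_ge0. Qed.

Lemma enorm_sq x : enorm x ^+ 2 = \sum_(j < d) x 0 j ^+ 2.
Proof. by rewrite sqr_sqrtr// sumr_ge0// => j _; exact: sqr_ge0. Qed.

Lemma enormZ (a : R) x : enorm (a *: x) = `|a| * enorm x.
Proof.
rewrite -sqrtr_sqr -sqrtrM ?sqr_ge0//; congr Num.sqrt.
by rewrite mulr_sumr; apply: eq_bigr => j _; rewrite mxE exprMn.
Qed.

Lemma coord_le_enorm x j : `|x 0 j| <= enorm x.
Proof.
rewrite -sqrtr_sqr ler_wsqrtr// (bigD1 j)//= lerDl.
by apply: sumr_ge0 => i _; exact: sqr_ge0.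
Qed.

(* Cauchy-Schwarz with the non-optimal constant [d]. *)
Lemma dot_le x y : `|dot x y| <= d%:R * (enorm x * enorm y).
Proof.
apply: le_trans (ler_norm_sum _ _ _) _.
apply: (@le_trans _ _ (\sum_(j < d) enorm x * enorm y)).
  by apply: ler_sum => j _; rewrite normrM ler_pM// coord_le_enorm.
by rewrite sumr_const card_ord mulr_natl.
Qed.

Lemma is_derive_line (g : 'rV[R]_d -> R) x v (t l : R) :
  is_derive (x + t *: v) v g l ->
  is_derive t 1 (fun u : R => g (x + u *: v)) l.
Proof.
have E : (fun h : R => h^-1 *: (((fun u : R => g (x + u *: v)) \o shift t) (h *: 1)
          - g (x + t *: v))) =
       (fun h : R => h^-1 *: ((g \o shift (x + t *: v)) (h *: v) - g (x + t *: v))).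
  apply/funext => h /=; congr (_ *: (g _ - _)).
  by rewrite scalerDl addrCA; congr (_ *: _ + _); rewrite /GRing.scale/= mulr1.
case=> dg <-; apply: DeriveDef; first by rewrite /derivable E; exact: dg.
by rewrite /derive E.
Qed.

(** The mean value theorem on the segment gives [g (x + v) - g x] as [dot (G y) v] at an
    intermediate point [y], and Cauchy-Schwarz bounds the change of [G]. It serves both for each
    [f ^~ s] and for [F]. *)
Lemma first_order_approx (g : 'rV[R]_d -> R) (G : 'rV[R]_d -> 'rV[R]_d) x v (k : R) :
  (forall t : R, 0 <= t <= 1 -> is_derive (x + t *: v) v g (dot (G (x + t *: v)) v)) ->
  (forall t : R, 0 <= t <= 1 -> enorm (G (x + t *: v) - G x) <= k) ->
  `|g (x + v) - g x - dot (G x) v| <= d%:R * (k * enorm v).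
Proof.
move=> dg Gk; pose phi (u : R) := g (x + u *: v).
have dphi (t : R) : 0 <= t <= 1 -> is_derive t 1 phi (dot (G (x + t *: v)) v).
  by move=> t01; apply: is_derive_line; exact: dg.
have [||c /[!in_itv]/= /andP[c0 c1]] :=
    @MVT R phi (fun t => dot (G (x + t *: v)) v) 0 1 ltr01.
- by move=> t /[!in_itv]/= /andP[t0 t1]; apply: dphi; rewrite !ltW.
- apply: derivable_within_continuous => t /[!in_itv]/= t01.
  by have [] := dphi t t01.
rewrite /phi scale1r scale0r addr0 subr0 mulr1 => ->.
rewrite -dotBl; apply: le_trans (dot_le _ _) _.
rewrite ler_wpM2l// ler_wpM2r ?enorm_ge0//.
by apply: Gk; rewrite !ltW.
Qed.

Lemma is_derive_quadratic (g : 'rV[R]_d -> R) (G : 'rV[R]_d) x v (k e : R) :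
  0 < e ->
  (forall u, enorm u < e -> `|g (x + u) - g x - dot G u| <= k * enorm u ^+ 2) ->
  is_derive x v g (dot G v).
Proof.
move=> e0 gk.
have cv : h^-1 *: ((g \o shift x) (h *: v) - g x) @[h --> (0:R)^'] --> dot G v.
  apply/cvgr_dnbhsP => u [u0 ucv].
  apply/cvgrPdist_le => r r0.
  (* The first bound keeps [u n *: v] inside the radius [e]; the second makes the quadratic
     remainder, divided by [u n], at most [r]. *)
  pose m := Num.min (e / (1 + enorm v)) (r / (1 + `|k| * enorm v ^+ 2)).
  have v1 : 0 < 1 + enorm v by rewrite ltr_wpDr ?enorm_ge0.
  have k1 : 0 < 1 + `|k| * enorm v ^+ 2.
    by apply: ltr_pwDl => //; apply: mulr_ge0 => //; exact: sqr_ge0.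
  have m0 : 0 < m by rewrite lt_min !divr_gt0.
  move/cvgrPdist_lt : ucv => /(_ _ m0); apply: filterS => n.
  rewrite sub0r normrN lt_min => /andP[ue ur].
  have un0 : 0 < `|u n| by rewrite normr_gt0.
  have := gk (u n *: v); rewrite enormZ => /(_ _).
  rewrite (le_lt_trans _ (_ : `|u n| * (1 + enorm v) < e)); last 2 first.
  - by rewrite ler_wpM2l// lerDr.
  - by rewrite -ltr_pdivlMr.
  move=> /(_ isT) h.
  have -> : dot G v - (u n)^-1 *: ((g \o shift x) (u n *: v) - g x) =
      - ((u n)^-1 * (g (x + u n *: v) - g x - dot G (u n *: v))).
    rewrite /= dotZr [_ *: v + x]addrC /GRing.scale/=.
    by field; exact: u0.
  rewrite normrN normrM normfV ler_pdivrMl//; apply: le_trans h _.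
  have -> : k * (`|u n| * enorm v) ^+ 2 = `|u n| * (`|u n| * (k * enorm v ^+ 2)) by ring.
  rewrite ler_pM2l//; rewrite ltr_pdivlMr// in ur; apply: le_trans (ltW ur).
  rewrite ler_pM2l//; apply: (@le_trans _ _ (`|k| * enorm v ^+ 2)); last by rewrite lerDr.
  by rewrite ler_wpM2r ?sqr_ge0// ler_norm.
apply: DeriveDef; first exact: cvgP cv.
exact: cvg_lim cv.
Qed.

End euclidean.

Lemma differentiable_is_derive_dot {R : realType} {d : nat} (g : 'rV[R]_d -> R) x v :
  differentiable g x -> is_derive x v g (dot (grad g x) v).
Proof.
move=> dg; apply: DeriveDef; first exact: diff_derivable.
rewrite deriveE// {1}(row_sum_delta v) linear_sum; apply: eq_bigr => j _.
by rewrite linearZ/= mxE deriveE// /GRing.scale/= mulrC.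
Qed.

Lemma hpowE {R : realType} {d : nat} (x : 'rV[R]_d) k j : hpow x k 0 j = x 0 j ^+ k.
Proof. by rewrite mxE. Qed.

Section Rintegral.
Context {dT : measure_display} {T : measurableType dT} {R : realType}.
Variable mu : {measure set T -> \bar R}.

Lemma integrableD_EFin (g h : T -> R) :
  mu.-integrable setT (EFin \o g) -> mu.-integrable setT (EFin \o h) ->
  mu.-integrable setT (EFin \o (fun t => g t + h t)).
Proof. by move=> ig ih; have := integrableD measurableT ig ih. Qed.

Lemma integrableB_EFin (g h : T -> R) :
  mu.-integrable setT (EFin \o g) -> mu.-integrable setT (EFin \o h) ->
  mu.-integrable setT (EFin \o (fun t => g t - h t)).
Proof. by move=> ig ih; have := integrableB measurableT ig ih. Qed.

Lemma integrableZl_EFin (a : R) (g : T -> R) :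
  mu.-integrable setT (EFin \o g) ->
  mu.-integrable setT (EFin \o (fun t => a * g t)).
Proof. by move=> ig; have := integrableZl measurableT a ig. Qed.

Lemma integrableZr_EFin (a : R) (g : T -> R) :
  mu.-integrable setT (EFin \o g) ->
  mu.-integrable setT (EFin \o (fun t => g t * a)).
Proof. by move=> ig; have := integrableZr measurableT a ig. Qed.

Lemma integrable_sum_EFin {I : Type} (s : seq I) (h : I -> T -> R) :
  (forall i, mu.-integrable setT (EFin \o h i)) ->
  mu.-integrable setT (EFin \o (fun t => \sum_(i <- s) h i t)).
Proof.
move=> ih; have := @integrable_sum _ _ _ mu setT measurableT _ s xpredT
  (fun i => EFin \o h i) (fun i _ => ih i).
by apply: eq_integrable => // t _ /=; rewrite sumEFin.
Qed.

Lemma Rintegral_sum {I : Type} (s : seq I) (h : I -> T -> R) :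
  (forall i, mu.-integrable setT (EFin \o h i)) ->
  \int[mu]_t (\sum_(i <- s) h i t) = \sum_(i <- s) \int[mu]_t h i t.
Proof.
move=> ih; elim: s => [|i s IH].
  rewrite big_nil; transitivity (\int[mu]_t (0 : R)).
    by apply: eq_Rintegral => t _; rewrite big_nil.
  by rewrite /Rintegral integral0.
rewrite big_cons; transitivity (\int[mu]_t (h i t + \sum_(j <- s) h j t)).
  by apply: eq_Rintegral => t _; rewrite big_cons.
by rewrite RintegralD ?IH//; exact: integrable_sum_EFin.
Qed.

End Rintegral.

(** * Differentiation under the expectation *)

Section gradient_of_expectation.
Context {R : realType} {d : nat} {dX : measure_display} {Xi : measurableType dX}.
Variables (mu : probability Xi R) (f kappa : 'rV[R]_d -> Xi -> R).
Hypothesis f_meas : measurable_fun setT (fun u : borel_rV R d * Xi => f u.1 u.2).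
Hypothesis f_int : forall x, mu.-integrable setT (fun s => (f x s)%:E).
Hypothesis f_diff : forall s x, differentiable (f ^~ s) x.
Hypothesis grad_sq_int : forall x j,
  mu.-integrable setT (fun s => (hpow (grad (f ^~ s) x) 2 0 j)%:E).
Hypothesis kappa_ge0 : forall x s, 0 <= kappa x s.
Hypothesis kappa_int : forall x, mu.-integrable setT (fun s => (kappa x s)%:E).
Hypothesis grad_loc_lip : forall x, exists2 e : R, 0 < e &
  forall s u v, eball x e u -> eball x e v ->
    enorm (grad (f ^~ s) u - grad (f ^~ s) v) <= kappa x s * enorm (u - v).
Variable F : 'rV[R]_d -> R.
Hypothesis F_def : forall x, F x = \int[mu]_s f x s.

Lemma measurable_grad x j : measurable_fun setT (fun s => grad (f ^~ s) x 0 j).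
Proof. exact: (@measurable_grad_param _ _ _ _ _ _ f f_meas f_diff (fun=> x) id). Qed.

(** Domination of [|a|] by [1 + a^2] on a probability space. *)
Lemma integrable_grad x j : mu.-integrable setT (fun s => (grad (f ^~ s) x 0 j)%:E).
Proof.
apply: (le_integrable measurableT (g := fun s => (1 + hpow (grad (f ^~ s) x) 2 0 j)%:E)).
- by apply/measurable_EFinP; exact: measurable_grad.
- move=> s _; rewrite hpowE; set a := grad (f ^~ s) x 0 j.
  rewrite !abse_EFin lee_fin.
  rewrite [leRHS]ger0_norm ?addr_ge0 ?sqr_ge0// -real_normK ?num_real//.
  by have := sqr_ge0 (`|a| - 1); nra.
- by apply: (@integrableD _ _ _ mu setT measurableT (cst 1%E)
    (fun s => (hpow (grad (f ^~ s) x) 2 0 j)%:E)); [exact: finite_measure_integrable_cst|].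
Qed.

(** The local Lipschitz bound makes the Taylor remainder of [f ^~ s] at [x] at most
    [d * kappa x s * |u|^2]. Integrating it leaves a quadratic remainder for [F], which determines
    the derivative. *)
Lemma is_derive_expectation x v :
  is_derive x v F (dot (\row_j \int[mu]_s grad (f ^~ s) x 0 j) v).
Proof.
have [e e0 lip] := grad_loc_lip x.
apply: (is_derive_quadratic (k := d%:R * \int[mu]_s kappa x s) v e0) => u ue.
pose D s := f (x + u) s - f x s - dot (grad (f ^~ s) x) u.
have iB : mu.-integrable setT (EFin \o (fun s => f (x + u) s - f x s)).
  by apply: integrableB_EFin; exact: f_int.
have idot : forall j, mu.-integrable setT (EFin \o (fun s => grad (f ^~ s) x 0 j * u 0 j)).
  by move=> j; apply: integrableZr_EFin; exact: integrable_grad.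
have iD : mu.-integrable setT (EFin \o D).
  by apply: integrableB_EFin => //; exact: integrable_sum_EFin.
have -> : F (x + u) - F x - dot (\row_j \int[mu]_s grad (f ^~ s) x 0 j) u = \int[mu]_s D s.
  rewrite RintegralB//; last exact: integrable_sum_EFin.
  rewrite RintegralB//; [|exact: f_int|exact: f_int].
  rewrite -!F_def Rintegral_sum//; congr (_ - _).
  by apply: eq_bigr => j _; rewrite mxE RintegralZr//; exact: integrable_grad.
apply: le_trans (le_normr_Rintegral measurableT iD) _.
pose K := d%:R * (enorm u * enorm u).
have iK : mu.-integrable setT (EFin \o (fun s => K * kappa x s)).
  by apply: integrableZl_EFin; exact: kappa_int.
apply: (@le_trans _ _ (\int[mu]_s (K * kappa x s))); last first.
  by rewrite RintegralZl//; [rewrite /K expr2; nra|exact: kappa_int].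
apply: le_Rintegral => //; first exact: integrable_norm.
move=> s _; rewrite /K.
have := @first_order_approx _ _ (f ^~ s) (grad (f ^~ s)) x u (kappa x s * enorm u).
rewrite -mulrA mulrCA [_ * kappa _ _]mulrC !mulrA; apply.
  by move=> t _; exact: differentiable_is_derive_dot.
move=> t /andP[t0 t1].
have tu : enorm (t *: u) <= enorm u.
  by rewrite enormZ ger0_norm// ler_piMl ?enorm_ge0.
apply: le_trans (lip _ _ _ _ _) _.
- by rewrite /eball/= addrC addKr (le_lt_trans tu).
- by rewrite /eball/= subrr -(scale0r u) enormZ normr0 mul0r.
- by rewrite addrC addKr ler_wpM2l.
Qed.

Lemma grad_expectation x : grad F x = \row_j \int[mu]_s grad (f ^~ s) x 0 j.
Proof.
apply/rowP => j; rewrite mxE; have [_ ->] := is_derive_expectation x (delta_mx 0 j).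
by rewrite dot_delta.
Qed.

(** The descent lemma; the constant is [d * L] instead of [L / 2] because of the mean value form and
    the crude Cauchy-Schwarz constant. *)
Lemma expectation_descent (L : R) :
  (forall x y, enorm (grad F x - grad F y) <= L * enorm (x - y)) -> 0 <= L ->
  forall x v, F (x + v) <= F x + dot (grad F x) v + d%:R * L * enorm v ^+ 2.
Proof.
move=> FL L0 x v.
have H : `|F (x + v) - F x - dot (grad F x) v| <= d%:R * (L * enorm v * enorm v).
  apply: (@first_order_approx _ _ F (grad F)) => t.
    by move=> _; rewrite grad_expectation; exact: is_derive_expectation.
  move=> /andP[t0 t1]; apply: le_trans (FL _ _) _.
  by rewrite addrC addKr enormZ ler_wpM2l// ger0_norm// ler_piMl ?enorm_ge0.
have -> : d%:R * L * enorm v ^+ 2 = d%:R * (L * enorm v * enorm v) by ring.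
by move: (le_trans (ler_norm _) H); lra.
Qed.

(** Tonelli applies separately to the positive and the negative part of [f]; [F] is the difference
    of the two integrals. *)
Lemma measurable_expectation : measurable_fun setT (F : borel_rV R d -> R).
Proof.
pose fE (u : borel_rV R d * Xi) := (f u.1 u.2)%:E.
have mf : measurable_fun setT fE by exact/measurable_EFinP.
pose IE (x : borel_rV R d) := (fubini_F mu fE^\+ x - fubini_F mu fE^\- x)%E.
have mIE : measurable_fun setT IE.
  apply: emeasurable_funB; apply: measurable_fun_fubini_tonelli_F => //.
    exact: measurable_funepos.
  exact: measurable_funeneg.
have -> : F = fine \o IE.
  apply/funext => x; rewrite F_def /Rintegral integralE /= /IE /fubini_F.
  by congr (fine (_ - _)%E); apply: eq_integral => s _; rewrite ?funeposE ?funenegE.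


exact: (measurableT_comp (@fine_measurable R setT measurableT) mIE).
Qed.

End gradient_of_expectation.

(** * One step of the algorithm *)

Section scalar.
Context {R : realType}.
Implicit Types (a b g m h ga q r y D : R).

(* Completing the square in [a + b * g] absorbs the correlation between the
   new scaling [D'] and the sampled gradient [g]. *)
Lemma coord_energy_step (a b g G h ga K B D D' : R) : 0 <= D' -> D' <= D -> D' <= B ->
  0 <= h -> 0 <= K -> b = ga * h ->
  h * (G * - (ga * ((a + b * g) * D'))) + h * K * (ga * ((a + b * g) * D')) ^+ 2
    + 2^-1 * (a + b * g) ^+ 2 * D'
  <= D * (2^-1 * (a + b * (g - G)) ^+ 2
          + 2 * h * K * B * ga ^+ 2 * (a ^+ 2 + b ^+ 2 * g ^+ 2)).
Proof.
move=> D0 DD DB h0 K0 bE; set m := a + b * g.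
(* Completing the square only adds the nonnegative term [D' (b G)^2 / 2]; the result is a square, so
   [D'] may be raised to [D]. *)
have E1 : 2^-1 * m ^+ 2 * D' - b * G * m * D' <= D * (2^-1 * (a + b * (g - G)) ^+ 2).
  have -> : a + b * (g - G) = m - b * G by rewrite /m; ring.
  apply: (@le_trans _ _ (D' * (2^-1 * (m - b * G) ^+ 2))); last first.
    by rewrite ler_wpM2r// mulr_ge0// sqr_ge0.
  have := mulr_ge0 D0 (sqr_ge0 (b * G)); lra.
(* One factor [D'] is raised to [D], which is common to the whole right-hand side, and the other to
   the constant [B]. *)
have E2 : h * K * (ga * (m * D')) ^+ 2 <=
    D * (2 * h * K * B * ga ^+ 2 * (a ^+ 2 + b ^+ 2 * g ^+ 2)).
  have m2 : m ^+ 2 <= 2 * (a ^+ 2 + b ^+ 2 * g ^+ 2).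
    by have := sqr_ge0 (a - b * g); rewrite /m; lra.
  have hK : 0 <= h * K * ga ^+ 2.
    by apply: mulr_ge0; [exact: mulr_ge0|exact: sqr_ge0].
  have DB2 : D' ^+ 2 <= D * B by rewrite expr2 ler_pM.
  have -> : h * K * (ga * (m * D')) ^+ 2 = h * K * ga ^+ 2 * (m ^+ 2 * D' ^+ 2) by ring.
  have -> : D * (2 * h * K * B * ga ^+ 2 * (a ^+ 2 + b ^+ 2 * g ^+ 2)) =
    h * K * ga ^+ 2 * (2 * (a ^+ 2 + b ^+ 2 * g ^+ 2) * (D * B)) by ring.
  by rewrite ler_wpM2l//; apply: ler_pM => //; exact: sqr_ge0.
have -> : h * (G * - (ga * (m * D'))) = - (b * G * m * D') by rewrite bE; ring.
by move: E1 E2; lra.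
Qed.

(** With [y = ga * q], squaring reduces the claim to [(1 - y/4)^4 <= (1 + y^2)^2 (1 - y)]. Both
    sides begin with [1 - y]: this is where the ratio [1/4] between [r] and [q] comes from. The
    condition [y <= 1/2] settles the second-order terms. *)
Lemma damping_bound (ga q r v eps : R) : 0 < eps -> 0 <= v -> 0 <= ga -> 0 <= q ->
  ga * q <= 2^-1 -> ga * r <= 1 -> q / 4 <= r ->
  (1 - ga * r) ^+ 2 / Num.sqrt ((1 - ga * q) * v + eps) <=
  (1 + ga ^+ 2 * q ^+ 2) / Num.sqrt (v + eps).
Proof.
move=> eps0 v0 ga0 q0 gq gr qr; set y := ga * q.
have y0 : 0 <= y by exact: mulr_ge0.
have yr : y / 4 <= ga * r by rewrite -mulrA ler_wpM2l.
have vy : 0 < (1 - y) * v + eps by rewrite ltr_wpDl// mulr_ge0// /y; lra.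
have ve : 0 < v + eps by rewrite ltr_wpDl.
rewrite ler_pdivrMr ?sqrtr_gt0// mulrAC ler_pdivlMr ?sqrtr_gt0//.
have -> : ga ^+ 2 * q ^+ 2 = y ^+ 2 by rewrite /y; ring.
have E1 : (1 - ga * r) ^+ 2 <= (1 - y / 4) ^+ 2.
  by rewrite ler_sqr ?nnegrE; lra.
apply: le_trans (_ : (1 - y / 4) ^+ 2 * Num.sqrt (v + eps) <= _).
  by rewrite ler_wpM2r ?sqrtr_ge0.
have p1 : 0 <= (1 - y / 4) ^+ 2 by exact: sqr_ge0.
have p2 : 0 <= 1 + y ^+ 2 by have := sqr_ge0 y; lra.
rewrite -[X in X * _]ger0_norm// -[X in _ <= X * _]ger0_norm//.
rewrite -!sqrtr_sqr -!sqrtrM ?sqr_ge0// ler_wsqrtr//.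
have E2 : ((1 - y / 4) ^+ 2) ^+ 2 <= (1 + y ^+ 2) ^+ 2 * (1 - y).
  have y12 : y <= 2^-1 by [].
  have A : ((1 - y / 4) ^+ 2) ^+ 2 <= 1 - y + y ^+ 2 / 2.
    have -> : ((1 - y / 4) ^+ 2) ^+ 2 =
      1 - y + y ^+ 2 * (6 / 16 - y / 16 + y ^+ 2 / 256) by field.
    by rewrite lerD2l ler_wpM2l ?sqr_ge0//; nra.
  have -> : (1 + y ^+ 2) ^+ 2 * (1 - y) = 1 - y + y ^+ 2 * (2 + y ^+ 2) * (1 - y) by ring.
  apply: le_trans A _; rewrite lerD2l -mulrA ler_wpM2l ?sqr_ge0//.
  by have := sqr_ge0 y; nra.
apply: le_trans (_ : (1 + y ^+ 2) ^+ 2 * (1 - y) * (v + eps) <= _).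
  by rewrite ler_wpM2r// ltW.
(* What remains is [(1 - y) (v + eps) <= (1 - y) v + eps]. *)
rewrite -mulrA ler_wpM2l ?sqr_ge0//.
have := mulr_ge0 y0 (ltW eps0); lra.
Qed.

(** The squared positive part has the 2-Lipschitz derivative [2 max(0, t)]; this is its second-order
    upper bound. *)
Lemma quad_excess (v D c : R) :
  (Num.max 0 (v + D - c)) ^+ 2 <=
  (Num.max 0 (v - c)) ^+ 2 + 2 * Num.max 0 (v - c) * D + D ^+ 2.
Proof.
rewrite /Num.max; case: (ltP 0 (v + D - c)) => h1; case: (ltP 0 (v - c)) => h2; nra.
Qed.

End scalar.

Section moments.
Context {dX : measure_display} {Xi : measurableType dX} {R : realType}.
Variables (mu : probability Xi R) (g : Xi -> R).
Hypothesis ig : mu.-integrable setT (EFin \o g).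
Hypothesis ig2 : mu.-integrable setT (EFin \o (fun s => g s ^+ 2)).

Lemma integrable_cst_EFin (c : R) : mu.-integrable setT (EFin \o (fun=> c)).
Proof. exact: finite_measure_integrable_cst. Qed.

Lemma Rintegral_cst_prob (c : R) : \int[mu]_s c = c.
Proof. by rewrite Rintegral_cst//; have := probability_setT mu => /= ->; rewrite mulr1. Qed.

Lemma integrable_quadratic (a b c : R) :
  mu.-integrable setT (EFin \o (fun s => a + b * g s + c * g s ^+ 2)).
Proof.
apply: integrableD_EFin; last exact: integrableZl_EFin.
by apply: integrableD_EFin; [exact: integrable_cst_EFin|exact: integrableZl_EFin].
Qed.

Lemma Rintegral_quadratic (a b c : R) :
  \int[mu]_s (a + b * g s + c * g s ^+ 2) =
  a + b * \int[mu]_s g s + c * \int[mu]_s (g s ^+ 2).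
Proof.
rewrite RintegralD//; first last.
- exact: integrableZl_EFin.
- by apply: integrableD_EFin; [exact: integrable_cst_EFin|exact: integrableZl_EFin].
rewrite RintegralD//; first last.
- exact: integrableZl_EFin.
- exact: integrable_cst_EFin.
by rewrite !RintegralZl// Rintegral_cst_prob.
Qed.

Let energyE (a b k : R) : 
  (fun s => 2^-1 * (a + b * (g s - \int[mu]_s g s)) ^+ 2 +
            k * (a ^+ 2 + b ^+ 2 * g s ^+ 2)) =
  (fun s => (2^-1 * (a - b * \int[mu]_s g s) ^+ 2 + k * a ^+ 2) +
    (b * (a - b * \int[mu]_s g s)) * g s + ((2^-1 + k) * b ^+ 2) * g s ^+ 2).
Proof. by apply/funext => s; field. Qed.

Lemma integrable_energy (a b k : R) :
  mu.-integrable setT (EFin \o (fun s =>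
    2^-1 * (a + b * (g s - \int[mu]_s g s)) ^+ 2 + k * (a ^+ 2 + b ^+ 2 * g s ^+ 2))).
Proof. by rewrite energyE; exact: integrable_quadratic. Qed.

(** Centring [g] kills the cross term [a * b], so no drift linear in [b] survives, and the variance
    is at most the second moment. *)
Lemma Rintegral_energy (a b k : R) :
  \int[mu]_s (2^-1 * (a + b * (g s - \int[mu]_s g s)) ^+ 2 +
              k * (a ^+ 2 + b ^+ 2 * g s ^+ 2))
  <= (2^-1 + k) * (a ^+ 2 + b ^+ 2 * \int[mu]_s (g s ^+ 2)).
Proof.
rewrite energyE Rintegral_quadratic.
by have := sqr_ge0 (b * \int[mu]_s g s); lra.
Qed.

End moments.

Ltac nonneg := repeat first
  [ done | exact: sqr_ge0 | exact: sqrtr_ge0 | rewrite invr_ge0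
  | apply: addr_ge0 | apply: mulr_ge0 ].

Section one_step.
Context {R : realType} {d : nat} {dX : measure_display} {Xi : measurableType dX}.
Variables (mu : probability Xi R) (f : 'rV[R]_d -> Xi -> R) (F : 'rV[R]_d -> R).
Variables (eps : R).
Hypothesis eps_gt0 : 0 < eps.
Implicit Types (z : 'rV[R]_d * 'rV[R]_d * 'rV[R]_d) (ga h r p q : R) (j : 'I_d).

Local Notation step := (alg_step f eps).

Lemma step_v ga h r p q s z j : (step ga h r p q s z).1.1 0 j =
  (1 - ga * q) * z.1.1 0 j + ga * p * grad (f ^~ s) z.2 0 j ^+ 2.
Proof. by case: z => -[v m] x; rewrite /alg_step/= !mxE. Qed.

Lemma step_m ga h r p q s z j : (step ga h r p q s z).1.2 0 j =
  (1 - ga * r) * z.1.2 0 j + ga * h * grad (f ^~ s) z.2 0 j.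
Proof. by case: z => -[v m] x; rewrite /alg_step/= !mxE. Qed.

Definition increment ga h r p q s z : 'rV[R]_d :=
  \row_j (- (ga * ((step ga h r p q s z).1.2 0 j *
    (Num.sqrt ((step ga h r p q s z).1.1 0 j + eps))^-1))).

Lemma incrementE ga h r p q s z j : increment ga h r p q s z 0 j =
  - (ga * ((step ga h r p q s z).1.2 0 j *
    (Num.sqrt ((step ga h r p q s z).1.1 0 j + eps))^-1)).
Proof. by rewrite mxE. Qed.

Lemma step_x ga h r p q s z : (step ga h r p q s z).2 = z.2 + increment ga h r p q s z.
Proof.
by apply/rowP => j; rewrite /increment; case: z => -[v m] x; rewrite /alg_step/= !mxE.
Qed.

Definition energy h z : R :=
  h * (1 + F z.2) +
  \sum_(j < d) 2^-1 * z.1.2 0 j ^+ 2 * (Num.sqrt (z.1.1 0 j + eps))^-1.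

Variables (K C : R).
Hypothesis F_ge : forall x, 0 <= 1 + F x.
Hypothesis K_ge0 : 0 <= K.
Hypothesis C_ge0 : 0 <= C.
Hypothesis F_descent : forall x v,
  F (x + v) <= F x + dot (grad F x) v + K * enorm v ^+ 2.
Hypothesis grad_int : forall x j,
  mu.-integrable setT (fun s => (grad (f ^~ s) x 0 j)%:E).
Hypothesis grad_sq_int : forall x j,
  mu.-integrable setT (fun s => (grad (f ^~ s) x 0 j ^+ 2)%:E).
Hypothesis gradFE : forall x j, grad F x 0 j = \int[mu]_s grad (f ^~ s) x 0 j.
Hypothesis grad_mom2 : forall x,
  \sum_(j < d) \int[mu]_s (grad (f ^~ s) x 0 j ^+ 2) <= C * (1 + F x).

Lemma energy_ge0 h z : 0 <= h -> 0 <= energy h z.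
Proof.
move=> h0; apply: addr_ge0; [exact: mulr_ge0|apply: sumr_ge0 => j _].
by nonneg.
Qed.

Let B := (Num.sqrt eps)^-1.

Let B_ge0 : 0 <= B. Proof. by rewrite invr_ge0 sqrtr_ge0. Qed.

Lemma inv_sqrt_le_inv (a b : R) : 0 < a -> a <= b -> (Num.sqrt b)^-1 <= (Num.sqrt a)^-1.
Proof.
move=> a0 ab; have b0 := lt_le_trans a0 ab.
by rewrite lef_pV2 ?posrE ?sqrtr_gt0// ler_wsqrtr.
Qed.

Let Dt ga q z j := (Num.sqrt ((1 - ga * q) * z.1.1 0 j + eps))^-1.

(** The sample enters only through a quadratic polynomial in the gradient coordinate, so two moments
    determine the mean. *)
Let majorant ga h r q z s j : R := Dt ga q z j *
  (2^-1 * ((1 - ga * r) * z.1.2 0 j + ga * h * (grad (f ^~ s) z.2 0 j - grad F z.2 0 j)) ^+ 2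
   + 2 * h * K * B * ga ^+ 2 * (((1 - ga * r) * z.1.2 0 j) ^+ 2 +
                                (ga * h) ^+ 2 * grad (f ^~ s) z.2 0 j ^+ 2)).

(** The descent inequality for the displacement of [x], then [coord_energy_step] in each coordinate.
    The weight [h] is the same on both sides; its change with [n] is treated separately. *)
Lemma energy_step_le ga h r p q s z : (forall j, 0 <= z.1.1 0 j) ->
  0 <= ga -> 0 <= h -> 0 <= p -> 0 <= 1 - ga * q ->
  energy h (step ga h r p q s z) <=
  h * (1 + F z.2) + \sum_(j < d) majorant ga h r q z s j.
Proof.
move=> v0 ga0 h0 p0 gq0; rewrite /energy step_x; set dx := increment ga h r p q s z.
have Fx := F_descent z.2 dx.
apply: (@le_trans _ _ (h * (1 + F z.2) + (h * (dot (grad F z.2) dx + K * enorm dx ^+ 2) +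
    \sum_(j < d) 2^-1 * (step ga h r p q s z).1.2 0 j ^+ 2 *
      (Num.sqrt ((step ga h r p q s z).1.1 0 j + eps))^-1))).
  rewrite [leRHS]addrA lerD2r -mulrDr ler_wpM2l//; move: Fx; lra.
rewrite lerD2l enorm_sq /dot mulrDr !mulr_sumr -!big_split/=.
apply: ler_sum => j _; rewrite /dx incrementE step_m sqrrN (mulrA h K).
apply: coord_energy_step => //.
- have v1 : 0 <= (1 - ga * q) * z.1.1 0 j by rewrite mulr_ge0.
  apply: inv_sqrt_le_inv; first by rewrite ltr_wpDl.
  by rewrite step_v lerD2r lerDl; nonneg.
- apply: inv_sqrt_le_inv => //; rewrite lerDr step_v.
  by nonneg.
Qed.

Let integrable_majorant ga h r q z j :
  mu.-integrable setT (EFin \o (fun s => majorant ga h r q z s j)).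
Proof.
apply: integrableZl_EFin; rewrite gradFE.
exact: (integrable_energy (grad_int z.2 j) (grad_sq_int z.2 j)).
Qed.

Let Rintegral_majorant ga h r q z j : 
  \int[mu]_s (majorant ga h r q z s j) <= Dt ga q z j * (2^-1 + 2 * h * K * B * ga ^+ 2) *
  (((1 - ga * r) * z.1.2 0 j) ^+ 2 + (ga * h) ^+ 2 * \int[mu]_s (grad (f ^~ s) z.2 0 j ^+ 2)).
Proof.
rewrite RintegralZl// ?gradFE; last first.
  exact: (integrable_energy (grad_int z.2 j) (grad_sq_int z.2 j)).
rewrite -[leRHS]mulrA; apply: ler_wpM2l; first by nonneg.
exact: (Rintegral_energy (grad_int z.2 j) (grad_sq_int z.2 j)).
Qed.

(** The first three terms come from expanding [(1 + c ga^2) (1 + Q^2 ga^2)] with [ga <= 1]; the last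
    is the contribution of the second moment of the gradient, bounded through [C]. *)
Definition energy_rate (H Q : R) : R :=
  let c := 4 * H * K * B in c + Q ^+ 2 + c * Q ^+ 2 + (2^-1 + c) * H * B * C.

Lemma energy_mean_step ga h r p q H Q z : (forall j, 0 <= z.1.1 0 j) ->
  0 <= ga <= 1 -> 0 <= h <= H -> 0 <= p -> 0 <= q <= Q -> ga * q <= 2^-1 ->
  ga * r <= 1 -> q / 4 <= r ->
  measurable_fun setT (fun s => energy h (step ga h r p q s z)) ->
  (\int[mu]_s (energy h (step ga h r p q s z))%:E <=
   ((1 + energy_rate H Q * ga ^+ 2) * energy h z)%:E)%E.
Proof.
move=> v0 /andP[ga0 ga1] /andP[h0 hH] p0 /andP[q0 qQ] gq gr qr mE.
have gq0 : 0 <= 1 - ga * q by lra.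
have iM : mu.-integrable setT (EFin \o (fun s =>
    h * (1 + F z.2) + \sum_(j < d) majorant ga h r q z s j)).
  by apply: integrableD_EFin; [exact: integrable_cst_EFin|exact: integrable_sum_EFin].
have M : (\int[mu]_s (energy h (step ga h r p q s z))%:E <=
    (\int[mu]_s (h * (1 + F z.2) + \sum_(j < d) majorant ga h r q z s j))%:E)%E.
  rewrite /Rintegral fineK; last exact: integrable_fin_num.
  apply: ge0_le_integral => //.
  - by move=> s _; rewrite lee_fin energy_ge0.
  - exact/measurable_EFinP.
  - by have /integrableP[] := iM.
  - by move=> s _; rewrite lee_fin; exact: energy_step_le.
apply: le_trans M _; rewrite lee_fin.
rewrite RintegralD//; last 2 first.
- exact: integrable_cst_EFin.
- exact: integrable_sum_EFin.
rewrite Rintegral_cst_prob Rintegral_sum//.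
set k := 2 * h * K * B * ga ^+ 2.
have k0 : 0 <= k by nonneg.
pose S j := \int[mu]_s (grad (f ^~ s) z.2 0 j ^+ 2).
have S0 j : 0 <= S j by apply: Rintegral_ge0 => s _; exact: sqr_ge0.
pose E j := 2^-1 * z.1.2 0 j ^+ 2 * (Num.sqrt (z.1.1 0 j + eps))^-1.
have E0 j : 0 <= E j by nonneg.
have coord j : \int[mu]_s (majorant ga h r q z s j) <=
    (1 + 2 * k) * (1 + ga ^+ 2 * q ^+ 2) * E j + (2^-1 + k) * (ga * h) ^+ 2 * B * S j.
  apply: le_trans (Rintegral_majorant _ _ _ _ _ _) _; rewrite -/k -/(S j).
  have D1 := @damping_bound _ ga q r (z.1.1 0 j) eps eps_gt0 (v0 j) ga0 q0 gq gr qr.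
  have D2 : Dt ga q z j <= B.
    by apply: inv_sqrt_le_inv => //; rewrite lerDr mulr_ge0.
  have -> : Dt ga q z j * (2^-1 + k) * (((1 - ga * r) * z.1.2 0 j) ^+ 2 + (ga * h) ^+ 2 * S j)
      = (2^-1 + k) * z.1.2 0 j ^+ 2 *
        ((1 - ga * r) ^+ 2 / Num.sqrt ((1 - ga * q) * z.1.1 0 j + eps))
      + (2^-1 + k) * (ga * h) ^+ 2 * S j * Dt ga q z j by rewrite /Dt; ring.
  have -> : (1 + 2 * k) * (1 + ga ^+ 2 * q ^+ 2) * E j =
     (2^-1 + k) * z.1.2 0 j ^+ 2 * ((1 + ga ^+ 2 * q ^+ 2) / Num.sqrt (z.1.1 0 j + eps)).
    by rewrite /E; field; rewrite gt_eqF// sqrtr_gt0 ltr_wpDl.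
  apply: lerD; first by apply: ler_wpM2l => //; nonneg.
  by rewrite [leRHS]mulrAC; apply: ler_wpM2l => //; nonneg.
apply: (@le_trans _ _ (h * (1 + F z.2) +
  \sum_(j < d) ((1 + 2 * k) * (1 + ga ^+ 2 * q ^+ 2) * E j +
     (2^-1 + k) * (ga * h) ^+ 2 * B * S j))).
  by rewrite lerD2l; apply: ler_sum => j _; exact: coord.
rewrite big_split/= -!mulr_sumr.
have SC : \sum_(j < d) S j <= C * (1 + F z.2) := grad_mom2 z.2.
rewrite /energy -/(E _); set T := \sum_(j < d) E j.
have T0 : 0 <= T by apply: sumr_ge0.
set a := 1 + F z.2; have a0 : 0 <= a := F_ge z.2.
rewrite /energy_rate; set c := 4 * H * K * B.
have H0 : 0 <= H by exact: le_trans hH.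
have Q0 : 0 <= Q by exact: le_trans qQ.
have c0 : 0 <= c by nonneg.
have g2 : 0 <= ga ^+ 2 by exact: sqr_ge0.
have g21 : ga ^+ 2 <= 1 by rewrite expr_le1.
have k2c : 2 * k <= c * ga ^+ 2.
  rewrite /k /c; have -> : 2 * (2 * h * K * B * ga ^+ 2) = 4 * h * (K * B * ga ^+ 2) by ring.
  rewrite -!mulrA (mulrA H) (mulrA (H * K)) !mulrA.
  by rewrite !ler_wpM2r// ler_wpM2l.
have q2Q : q ^+ 2 <= Q ^+ 2 by rewrite ler_sqr ?nnegrE.
have A1 : (1 + 2 * k) * (1 + ga ^+ 2 * q ^+ 2) <= 1 + (c + Q ^+ 2 + c * Q ^+ 2) * ga ^+ 2.
  apply: (@le_trans _ _ ((1 + c * ga ^+ 2) * (1 + ga ^+ 2 * Q ^+ 2))).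
    apply: ler_pM; [by nonneg|by nonneg| |].
      by rewrite lerD2l.
    by rewrite lerD2l ler_wpM2l.
  have := mulr_ge0 (mulr_ge0 c0 (sqr_ge0 Q)) g2.
  have : c * Q ^+ 2 * ga ^+ 2 * ga ^+ 2 <= c * Q ^+ 2 * ga ^+ 2 * 1.
    by apply: ler_wpM2l => //; nonneg.
  by lra.
have kc : k <= c.
  have : c * ga ^+ 2 <= c * 1 by rewrite ler_wpM2l.
  by move: k2c k0; lra.
(* Only one of the two factors [h] is bounded by [H]; the other rebuilds the term [h * (1 + F)] of
   the energy. *)
have A2 : (2^-1 + k) * (ga * h) ^+ 2 * B * \sum_(j < d) S j <=
    (2^-1 + c) * H * B * C * ga ^+ 2 * (h * a).
  have -> : (2^-1 + c) * H * B * C * ga ^+ 2 * (h * a) =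
    (2^-1 + c) * (ga ^+ 2 * (h * H)) * B * (C * a) by ring.
  apply: ler_pM => //; [|exact: sumr_ge0|].
    by nonneg.
  rewrite ler_wpM2r//; apply: ler_pM; [by rewrite addr_ge0|exact: sqr_ge0| |].
    by rewrite lerD2l.
  by rewrite exprMn ler_wpM2l// expr2 ler_wpM2l.
have A3 : (1 + 2 * k) * (1 + ga ^+ 2 * q ^+ 2) * T <=
    (1 + (c + Q ^+ 2 + c * Q ^+ 2) * ga ^+ 2) * T by rewrite ler_wpM2r.
have A4 : 0 <= (c + Q ^+ 2 + c * Q ^+ 2) * ga ^+ 2 * (h * a).
  by nonneg.
have A5 : 0 <= (2^-1 + c) * H * B * C * ga ^+ 2 * T.
  by nonneg.
by move: A2 A3 A4 A5; lra.
Qed.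

(** The added 1 lets the additive errors of order [ga^2] be absorbed into a multiplicative
    factor. *)
Definition excess (c : R) j z : R := 1 + Num.max 0 (z.1.1 0 j - c) ^+ 2.

Lemma excess_ge0 c j z : 0 <= excess c j z.
Proof. by rewrite /excess; nonneg. Qed.

(* The threshold [c] is chosen so that the drift of [v] is nonpositive above it. *)
Lemma excess_mean_step ga h r p q (S2 S4 pmax qmin qmax c : R) z j :
  0 <= z.1.1 0 j -> 0 <= ga -> 0 <= p <= pmax -> 0 < qmin -> qmin <= q <= qmax ->
  c = pmax * S2 / qmin ->
  mu.-integrable setT (EFin \o (fun s => (grad (f ^~ s) z.2 0 j ^+ 2) ^+ 2)) ->
  \int[mu]_s (grad (f ^~ s) z.2 0 j ^+ 2) <= S2 ->
  \int[mu]_s ((grad (f ^~ s) z.2 0 j ^+ 2) ^+ 2) <= S4 ->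
  measurable_fun setT (fun s => excess c j (step ga h r p q s z)) ->
  (\int[mu]_s (excess c j (step ga h r p q s z))%:E <=
   ((1 + (2 * pmax ^+ 2 * S4 + 4 * qmax ^+ 2 * (1 + c ^+ 2)) * ga ^+ 2)
    * excess c j z)%:E)%E.
Proof.
move=> v0 ga0 /andP[p0 pp] qmin0 /andP[qq1 qq2] cE i4 HS2 HS4 mE.
set v := z.1.1 0 j in v0 *; pose g s := grad (f ^~ s) z.2 0 j ^+ 2.
set w := Num.max 0 (v - c); have w0 : 0 <= w by rewrite le_max lexx.
have i2 : mu.-integrable setT (EFin \o g) := grad_sq_int z.2 j.
(* From [quad_excess], with the square of the increment bounded by [2 ga^2 (p^2 g^2 + q^2 v^2)]. *)
pose up s := (1 + w ^+ 2 - 2 * w * ga * q * v + 2 * ga ^+ 2 * q ^+ 2 * v ^+ 2)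
  + 2 * w * ga * p * g s + 2 * ga ^+ 2 * p ^+ 2 * g s ^+ 2.
have iU : mu.-integrable setT (EFin \o up) by exact: integrable_quadratic.
have M : (\int[mu]_s (excess c j (step ga h r p q s z))%:E <= (\int[mu]_s up s)%:E)%E.
  rewrite /Rintegral fineK; last exact: integrable_fin_num.
  apply: ge0_le_integral => //.
  - by move=> s _; rewrite lee_fin excess_ge0.
  - exact/measurable_EFinP.
  - by have /integrableP[] := iU.
  - move=> s _; rewrite lee_fin /excess step_v -/v -/(g s).
    have -> : (1 - ga * q) * v + ga * p * g s - c = v + ga * (p * g s - q * v) - c by ring.
    have := quad_excess v (ga * (p * g s - q * v)) c; rewrite -/w /up.
    have := mulr_ge0 (sqr_ge0 ga) (sqr_ge0 (p * g s + q * v)); lra.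
apply: le_trans M _; rewrite lee_fin Rintegral_quadratic//.
set I2 := \int[mu]_s g s; set I4 := \int[mu]_s (g s ^+ 2).
have drift : w * ga * (p * I2 - q * v) <= 0.
  have [vc|cv] := leP v c.
    by rewrite /w max_l ?subr_le0// !mul0r.
  apply: mulr_ge0_le0; first exact: mulr_ge0.
  rewrite subr_le0; apply: (@le_trans _ _ (pmax * S2)).
    by apply: ler_pM => //; apply: Rintegral_ge0 => s _; exact: sqr_ge0.
  have -> : pmax * S2 = qmin * c by rewrite cE; field; rewrite gt_eqF.
  apply: ler_pM => //; [exact: ltW| |exact: ltW].
  rewrite cE; apply: divr_ge0; last exact: ltW.
  apply: mulr_ge0; first exact: le_trans pp.
  apply: le_trans HS2; apply: Rintegral_ge0 => s _; exact: sqr_ge0.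
have vw : v ^+ 2 <= 2 * w ^+ 2 + 2 * c ^+ 2.
  have h1 : v <= w + c by rewrite -lerBlDr le_max lexx orbT.
  have : v ^+ 2 <= (w + c) ^+ 2 by rewrite ler_sqr ?nnegrE// (le_trans v0).
  have := sqr_ge0 (w - c); lra.
have p2 : p ^+ 2 * I4 <= pmax ^+ 2 * S4.
  apply: ler_pM => //; [exact: sqr_ge0| |].
    by apply: Rintegral_ge0 => s _; exact: sqr_ge0.
  by rewrite ler_sqr ?nnegrE// (le_trans p0).
have q0 : 0 <= q by rewrite (le_trans _ qq1)// ltW.
have q2 : q ^+ 2 * v ^+ 2 <= qmax ^+ 2 * (2 * w ^+ 2 + 2 * c ^+ 2).
  apply: ler_pM => //; [exact: sqr_ge0|exact: sqr_ge0|].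
  by rewrite ler_sqr ?nnegrE// (le_trans q0).
have S40 : 0 <= pmax ^+ 2 * S4.
  apply: mulr_ge0; first exact: sqr_ge0.
  by apply: le_trans HS4; apply: Rintegral_ge0 => s _; exact: sqr_ge0.
rewrite /excess -/v -/w.
have g2 : 0 <= ga ^+ 2 by exact: sqr_ge0.
have := ler_wpM2l g2 p2; have := ler_wpM2l g2 q2.
have := mulr_ge0 (mulr_ge0 S40 (sqr_ge0 w)) g2.
have := mulr_ge0 (sqr_ge0 qmax) g2.
have := mulr_ge0 (mulr_ge0 (mulr_ge0 (sqr_ge0 qmax) (sqr_ge0 c)) (sqr_ge0 w)) g2.
move: drift; lra.
Qed.

End one_step.

(** * Boundedness of the iterates *)

Section lyapunov.
Context {dO dX : measure_display} {Omega : measurableType dO}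
  {Xi : measurableType dX} {R : realType} {S : Type}.
Variables (P : probability Omega R) (mu : probability Xi R).
Variable X : nat -> {RV P >-> Xi}.
Hypothesis X_law : forall n A, measurable A -> P (X n @^-1` A) = mu A.
Hypothesis X_indep : mutually_independent X.
Variables (step : nat -> Xi -> S -> S) (Z : nat -> Omega -> S).
Hypothesis ZE : forall n w, Z n.+1 w = step n (X n w) (Z n w).

Local Notation history n := (g_sigma_algebraType (cylinder X n)).

Lemma history_lt n (Y : history n -> R) (a : R) : measurable_fun setT Y ->
  <<s cylinder X n >> [set w | Y w < a].
Proof.
move=> mY; have := mY measurableT [set` `]-oo, a[] (measurable_itv _).
rewrite setTI; congr (measurable _); apply/seteqP; split => w /=;
  by rewrite in_itv.
Qed.

(** A Lyapunov criterion: a drift inequality at each fixed state of [D n] becomes, after integrating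
    out the fresh sample, an almost supermartingale inequality. Time is shifted by [n0]. *)
Lemma lyapunov_ae_bounded (V : nat -> S -> R) (D : nat -> set S)
    (c : nat -> R) (n0 : nat) (b : R) :
  (forall n z, 0 <= V n z) ->
  (forall n, measurable_fun setT (fun w : history n => V n (Z n w))) ->
  (forall n, measurable_fun setT
    (fun u : history n * Xi => V n.+1 (step n u.2 (Z n u.1)))) ->
  (forall n, <<s cylinder X n >> [set w | D n (Z n w)]) ->
  (forall n, 0 <= c n) -> (forall n, \prod_(k < n) (1 + c (n0 + k)%N) <= b) ->
  (forall n z, (n0 <= n)%N -> D n z ->
    \int[mu]_s (V n.+1 (step n s z))%:E <= ((1 + c n) * V n z)%:E)%E ->
  {ae P, forall w, (forall n, (n0 <= n)%N -> D n (Z n w)) ->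
    exists M, forall n, (n0 <= n)%N -> V n (Z n w) <= M}.
Proof.
move=> V0 mV mVs mD c0 cb drift.
pose G n := <<s cylinder X (n0 + n) >>.
have G_sigma n : sigma_algebra setT (G n) by exact: smallest_sigma_algebra.
have G_meas n A : G n A -> measurable A by exact: history_measurable.
have G_incr n : G n `<=` G n.+1 by rewrite /G addnS; exact: sub_historyS.
suff : {ae P, forall w, (forall n, D (n0 + n)%N (Z (n0 + n)%N w)) ->
    exists M, forall n, V (n0 + n)%N (Z (n0 + n)%N w) <= M}.
  apply: filterS => w h Dw.
  have [|M VM] := h; first by move=> n; apply: Dw; rewrite leq_addr.
  by exists M => n n0n; rewrite -(subnKC n0n).
apply: (@almost_supermartingale_ae_bounded _ _ _ P G G_sigma G_meas G_incr
  (fun n w => V (n0 + n)%N (Z (n0 + n)%N w))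
  (fun n => [set w | D (n0 + n)%N (Z (n0 + n)%N w)])
  (fun n => 1 + c (n0 + n)%N) b) => //.
- by move=> n a; exact: history_lt.
- by move=> n; exact: mD.
- by move=> n; rewrite lerDl.
- move=> n A GA AD; set N := (n0 + n)%N in GA AD *.
  rewrite addnS -/N.
  have mA := G_meas n A GA.
  have mVZ : measurable_fun A (EFin \o (fun w => V N (Z N w))).
    apply: measurable_funTS; apply/measurable_EFinP.
    exact: (measurableT_comp (mV N) (@measurable_id_history _ _ _ _ _ _ X N)).
  pose psi (u : history N * Xi) := (V N.+1 (step N u.2 (Z N u.1)))%:E.
  have mpsi : measurable_fun setT psi by apply/measurable_EFinP; exact: mVs.
  have psi0 u : (0 <= psi u)%E by rewrite lee_fin.
  transitivity (\int[P]_(w in A) psi (w, X N w) <=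
    (1 + c N)%:E * \int[P]_(w in A) (V N (Z N w))%:E)%E.
    by congr (_ <= _)%E; apply: eq_integral => w _; rewrite /psi /= -ZE.
  rewrite (ge0_integral_history X_law X_indep GA mpsi psi0).
  rewrite -ge0_integralZl_EFin//; first last.
  - by rewrite addr_ge0.
  - by move=> w _; rewrite lee_fin.
  apply: ge0_le_integral => //.
  - by move=> w _; apply: integral_ge0.
  - apply: measurable_funTS.
    exact: (measurableT_comp (measurable_fun_fubini_tonelli_F psi mpsi psi0)
      (@measurable_id_history _ _ _ _ _ _ X N)).
  - exact: measurable_funeM.
  - move=> w Aw; have := drift N (Z N w) (leq_addr _ _) (AD w Aw).
    by rewrite EFinM.
Qed.

End lyapunov.

Section measurable_state.
Context {R : realType} {d : nat} {dX : measure_display} {Xi : measurableType dX}.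
Variable (f : 'rV[R]_d -> Xi -> R).
Hypothesis f_meas : measurable_fun setT (fun u : borel_rV R d * Xi => f u.1 u.2).
Hypothesis f_diff : forall s x, differentiable (f ^~ s) x.
Variable eps : R.

Definition measurable_state {dT : measure_display} {T : measurableType dT}
    (Z : T -> 'rV[R]_d * 'rV[R]_d * 'rV[R]_d) : Prop :=
  forall j, [/\ measurable_fun setT (fun t => (Z t).1.1 0 j),
    measurable_fun setT (fun t => (Z t).1.2 0 j) &
    measurable_fun setT (fun t => (Z t).2 0 j)].

(** For [a >= 0], the inverse exceeds [a] exactly when [v > 0] and [a * sqrt v < 1]; where [v <= 0]
    the inverse is 0, which also explains the case [a < 0]. *)
Lemma measurable_inv_sqrt {dT : measure_display} {T : measurableType dT} (v : T -> R) :
  measurable_fun setT v -> measurable_fun setT (fun t => (Num.sqrt (v t))^-1).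
Proof.
move=> mv; apply: (measurability _ (RGenOInfty.measurableE R)) => _ [_ [a ->] <-].
have [a0|a0] := ltP a 0.
  rewrite (_ : _ @^-1` _ = setT) ?setTI//; apply/seteqP; split => t //= _.
  by rewrite in_itv/= andbT (lt_le_trans a0)// invr_ge0 sqrtr_ge0.
have ms : measurable_fun setT (fun t => a * Num.sqrt (v t)).
  apply: measurable_funM => //; apply: measurableT_comp mv.
  by apply: continuous_measurable_fun; exact: sqrt_continuous.
have -> : (fun t => (Num.sqrt (v t))^-1) @^-1` `]a, +oo[ =
    (v @^-1` `]0, +oo[) `&` ((fun t => a * Num.sqrt (v t)) @^-1` `]-oo, 1[).
  apply/seteqP; split => t /=; rewrite !in_itv/= !andbT.
    have [v0|v0] := ltP 0 (v t).
      by rewrite -[ltRHS]div1r ltr_pdivlMr ?sqrtr_gt0.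
    by rewrite ler0_sqrtr// invr0 ltNge a0.
  by move=> [v0]; rewrite -[in X in _ -> X]div1r ltr_pdivlMr ?sqrtr_gt0.
rewrite setTI; apply: measurableI; rewrite -[X in measurable X]setTI.
  exact: mv.
exact: ms.
Qed.

Lemma measurable_energy {dT : measure_display} {T : measurableType dT} F h Z :
  measurable_fun setT (F : borel_rV R d -> R) -> @measurable_state _ T Z ->
  measurable_fun setT (fun t => energy F eps h (Z t)).
Proof.
move=> mF mZ; rewrite /energy; apply: measurable_funD.
  apply: measurable_funM => //; apply: measurable_funD => //.
  have mx : measurable_fun setT (fun t => (Z t).2 : borel_rV R d).
    by apply: measurable_fun_rV => j; have [] := mZ j.
  exact: (measurableT_comp mF mx).
apply: measurable_sum => j; have [mv mm mx] := mZ j.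
apply: measurable_funM; last exact/measurable_inv_sqrt/measurable_funD.
by apply: measurable_funM => //; exact: measurable_funX.
Qed.

Lemma measurable_excess {dT : measure_display} {T : measurableType dT} c j Z :
  @measurable_state _ T Z -> measurable_fun setT (fun t => excess c j (Z t)).
Proof.
move=> mZ; have [mv mm mx] := mZ j.
apply: measurable_funD => //; apply: measurable_funX.
by apply: measurable_maxr => //; exact: measurable_funB.
Qed.

Lemma measurable_alg_step {dT : measure_display} {T : measurableType dT}
    ga h r p q (s : T -> Xi) Z : @measurable_state _ T Z -> measurable_fun setT s ->
  measurable_state (fun t => alg_step f eps ga h r p q (s t) (Z t)).
Proof.
move=> mZ ms.
have mg j : measurable_fun setT (fun t => grad (f ^~ (s t)) (Z t).2 0 j).
  by apply: measurable_grad_param => // i; have [] := mZ i.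
have mv j : measurable_fun setT (fun t => (alg_step f eps ga h r p q (s t) (Z t)).1.1 0 j).
  under eq_fun do rewrite step_v.
  have [m1 _ _] := mZ j; apply: measurable_funD; apply: measurable_funM => //.
  exact: measurable_funX.
have mm j : measurable_fun setT (fun t => (alg_step f eps ga h r p q (s t) (Z t)).1.2 0 j).
  under eq_fun do rewrite step_m.
  by have [_ m2 _] := mZ j; apply: measurable_funD; apply: measurable_funM.
move=> j; split => //.
under eq_fun do rewrite step_x mxE incrementE.
have [_ _ m3] := mZ j; apply: measurable_funD => //.
apply: measurableT_comp => //; apply: measurable_funM => //; apply: measurable_funM => //.
exact/measurable_inv_sqrt/measurable_funD.
Qed.

End measurable_state.

Lemma nonincreasing_ge_lim {R : realType} (g : R -> R) (l : R) :
  (forall s t : R, 0 < s -> s <= t -> g t <= g s) -> g t @[t --> +oo] --> l ->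
  forall t, 0 < t -> l <= g t.
Proof.
move=> gn gl t t0; apply: (cvgr_to_le gl).
have := @nbhs_pinfty_ge R t (num_real _).
by apply: filterS => u tu; exact: gn.
Qed.

Lemma prod_1D_le {R : realType} (u : nat -> R) (B : R) :
  (forall n, 0 <= u n) -> (forall n, \sum_(k < n) u k <= B) ->
  forall n, \prod_(k < n) (1 + u k) <= expR B.
Proof.
move=> u0 uB n; apply: (@le_trans _ _ (expR (\sum_(k < n) u k))); last by rewrite ler_expR.
elim: n => [|n IH]; first by rewrite !big_ord0 expR0.
rewrite !big_ord_recr/= expRD; apply: ler_pM => //; last exact: expR_ge1Dx.
  by apply: prodr_ge0 => k _; rewrite addr_ge0.
by rewrite addr_ge0.
Qed.

Lemma compact_box {R : realType} (d : nat) (K : R) :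
  compact [set x : 'rV[R]_d | forall j, `|x 0 j| <= K].
Proof.
have := @rV_compact R d (fun=> `[- K, K]%classic) (fun=> @segment_compact _ _ _).
congr compact; apply/seteqP; split => x /= h j; have := h j;
  by rewrite in_itv/= ler_norml.
Qed.

Lemma eventually_bounded_fun {R : realType} {V : normedModType R} (u : nat -> V) n0 (M : R) :
  (forall n, (n0 <= n)%N -> `|u n| <= M) -> bounded_fun u.
Proof.
move=> uM; exists (\sum_(k < n0) `|u k| + `|M|); split; first exact: num_real.
move=> M' /ltW MM' n _ /=; apply: le_trans MM'.
have [n0n|nn0] := leqP n0 n.
  apply: le_trans (uM n n0n) _; apply: le_trans (ler_norm _) _.
  by rewrite lerDr sumr_ge0.
rewrite (bigD1 (Ordinal nn0))//= -addrA lerDl addr_ge0//.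
by rewrite sumr_ge0.
Qed.

Lemma norm_triple_le {R : realType} {d : nat} (z : 'rV[R]_d * 'rV[R]_d * 'rV[R]_d) (M : R) :
  0 <= M -> (forall j, [/\ `|z.1.1 0 j| <= M, `|z.1.2 0 j| <= M & `|z.2 0 j| <= M]) ->
  `|z| <= M.
Proof.
move=> M0 zM; have row_le (x : 'rV[R]_d) : (forall j, `|x 0 j| <= M) -> `|x| <= M.
  move=> xM; have -> : `|x| = mx_norm x by [].
  rewrite mx_normrE; apply: bigmax_le => // -[i j] _.
  by rewrite /= (ord1 i).
rewrite !prod_normE !ge_max; apply/andP; split; last first.
  by apply: row_le => j; have [] := zM j.
by apply/andP; split; apply: row_le => j; have [] := zM j.
Qed.

Section step_sizes.
Context {R : realType}.
Variable gamma : nat -> R.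
Hypothesis gamma_gt0 : forall n, (1 <= n)%N -> 0 < gamma n.

Lemma tau_gt0 n : (1 <= n)%N -> 0 < tau gamma n.
Proof.
case: n => // n _; rewrite /tau big_nat_recl//=.
apply: ltr_pwDl; first exact: gamma_gt0.
by apply: sumr_ge0 => k _; rewrite ltW// gamma_gt0.
Qed.

Lemma tau_le m n : (m <= n)%N -> tau gamma m <= tau gamma n.
Proof.
move=> mn; rewrite /tau [leRHS](big_cat_nat (n := m.+1))//= lerDl big_nat.
by apply: sumr_ge0 => k /andP[mk _]; rewrite ltW// gamma_gt0// (leq_trans _ mk).
Qed.

(** Transfers limits of the coefficients as time grows to limits along the index [n]. *)
Lemma tau_unbounded (T : R) : (\sum_(1 <= n <oo) (gamma n)%:E = +oo)%E ->
  exists N, T < tau gamma N.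
Proof.
move=> goo; apply: contrapT => /forallNP tT.
suff : (\sum_(1 <= n <oo) (gamma n)%:E <= T%:E)%E by rewrite goo.
apply: lime_le.
  by apply: is_cvg_nneseries => n n1 _; rewrite lee_fin ltW// gamma_gt0.
apply: nearW => -[|n]; rewrite sumEFin lee_fin; last by rewrite leNgt; apply/negP/tT.
rewrite big_geq//; have := tT 0%N; rewrite /tau big_geq// => /negP.
by rewrite -leNgt.
Qed.

Hypothesis gamma_sq_sum : (\sum_(1 <= n <oo) (gamma n ^+ 2)%:E < +oo)%E.

Lemma gamma_sq_bounded : exists B, forall m n, \sum_(k < n) gamma (m + k).+1 ^+ 2 <= B.
Proof.
have pos k : (1 <= k)%N -> true -> (0 <= (gamma k ^+ 2)%:E)%E.
  by move=> _ _; rewrite lee_fin sqr_ge0.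
have S0 : (0 <= \sum_(1 <= n <oo) (gamma n ^+ 2)%:E)%E by apply: nneseries_ge0.
exists (fine (\sum_(1 <= n <oo) (gamma n ^+ 2)%:E)) => m n.
rewrite -lee_fin fineK ?ge0_fin_numE//.
apply: le_trans (nneseries_lim_ge (m + n).+1 pos).
rewrite sumEFin lee_fin (big_cat_nat (n := m.+1))//=; last by rewrite ltnS leq_addr.
rewrite -[leLHS]add0r; apply: lerD; first by apply: sumr_ge0 => k _; exact: sqr_ge0.
rewrite -{1}[m.+1]add0n big_addn subSS addKn big_mkord.
by apply: ler_sum => k _; rewrite addnS addnC.
Qed.

Lemma gamma_small (e : R) : 0 < e -> exists N, forall n, (N <= n)%N -> gamma n.+1 <= e.
Proof.
move=> e0; have [B sB] := gamma_sq_bounded.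
have cv : cvgn (series (fun k => gamma k.+1 ^+ 2)).
  apply: nondecreasing_is_cvgn.
    by apply: nondecreasing_series => k _ _; exact: sqr_ge0.
  exists B => _ [n _ <-]; rewrite /series /= big_mkord.
  exact: sB 0%N n.
have /cvgrPdist_lt /(_ (e ^+ 2) (exprn_gt0 _ e0)) [N _ HN] := cvg_series_cvg_0 cv.
exists N => n Nn; have := HN n Nn; rewrite /= sub0r normrN ger0_norm ?sqr_ge0//.
have g0 : 0 <= gamma n.+1 by rewrite ltW// gamma_gt0.
by move=> /ltW; rewrite ler_sqr ?nnegrE// ltW.
Qed.

End step_sizes.

Theorem theorem3p2
  (R : realType) (d : nat) (d_ge1 : (1 <= d)%N)
  (dX dO : measure_display)
  (Xi : measurableType dX) (mu : probability Xi R)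
  (Omega : measurableType dO) (P : probability Omega R)
  (f : 'rV[R]_d -> Xi -> R) (kappa : 'rV[R]_d -> Xi -> R)
  (* assumptions on f *)
  (f_meas : measurable_fun setT (fun u : borel_rV R d * Xi => f u.1 u.2))
  (f_int : forall x, mu.-integrable setT (fun s => (f x s)%:E))
  (f_diff : forall s x, differentiable (f ^~ s) x)
  (grad_sq_int : forall x j,
     mu.-integrable setT (fun s => (hpow (grad (f ^~ s) x) 2 0 j)%:E))
  (kappa_meas :
     measurable_fun setT (fun u : borel_rV R d * Xi => kappa u.1 u.2))
  (kappa_ge0 : forall x s, 0 <= kappa x s)
  (kappa_int : forall x, mu.-integrable setT (fun s => (kappa x s)%:E))
  (grad_loc_lip : forall x, exists2 e : R, 0 < e &
     forall s u v, eball x e u -> eball x e v ->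
       Num.max
         (enorm (grad (f ^~ s) u - grad (f ^~ s) v))
         (enorm (hpow (grad (f ^~ s) u) 2 - hpow (grad (f ^~ s) v) 2))
       <= kappa x s * enorm (u - v))
  (F : 'rV[R]_d -> R)
  (F_def : forall x, F x = \int[mu]_s f x s)
  (* algorithm *)
  (gamma : nat -> R) (gamma_gt0 : forall n, (1 <= n)%N -> 0 < gamma n)
  (xi : nat -> {RV P >-> Xi})
  (xi_law : forall n, (1 <= n)%N -> forall A, measurable A ->
     distribution P (xi n) A = mu A)
  (xi_indep : mutually_independent (fun n => xi n.+1))
  (h0 r0 p0 q0 : R) (h r p q : R -> R)
  (h0_gt0 : 0 < h0) (r0_gt0 : 0 < r0) (p0_gt0 : 0 < p0) (q0_gt0 : 0 < q0)
  (gamma_q : forall n, 0 <= 1 - gamma n.+1 * coef gamma q0 q n)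
  (eps : R) (eps_gt0 : 0 < eps)
  (v0 m0 x0 : 'rV[R]_d) (v0_ge0 : forall j, 0 <= v0 0 j)
  (* (1) *)
  (F_coercive : forall A : R, exists B : R, forall x, B <= enorm x -> A <= F x)
  (* (2) *)
  (h_ge0 : forall t : R, 0 < t -> 0 <= h t)
  (r_ge0 : forall t : R, 0 < t -> 0 <= r t)
  (p_ge0 : forall t : R, 0 < t -> 0 <= p t)
  (q_ge0 : forall t : R, 0 < t -> 0 <= q t)
  (h_cont : forall t : R, 0 < t -> {for t, continuous h})
  (r_cont : forall t : R, 0 < t -> {for t, continuous r})
  (p_cont : forall t : R, 0 < t -> {for t, continuous p})
  (q_cont : forall t : R, 0 < t -> {for t, continuous q})
  (h_derivable : forall t : R, 0 < t -> derivable h t 1)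
  (h_C1 : forall t : R, 0 < t -> {for t, continuous (derive1 h)})
  (h_deriv_le0 : forall t : R, 0 < t -> derive1 h t <= 0)
  (r_noninc : forall s t : R, 0 < s -> s <= t -> r t <= r s)
  (q_noninc : forall s t : R, 0 < s -> s <= t -> q t <= q s)
  (h_inf r_inf p_inf q_inf : R)
  (h_lim : h t @[t --> +oo] --> h_inf) (h_inf_gt0 : 0 < h_inf)
  (r_lim : r t @[t --> +oo] --> r_inf) (r_inf_gt0 : 0 < r_inf)
  (q_lim : q t @[t --> +oo] --> q_inf) (q_inf_gt0 : 0 < q_inf)
  (p_lim : p t @[t --> +oo] --> p_inf)
  (r_ge_q4 : forall t : R, 0 < t -> q t / 4 <= r t)
  (r_gt_q4_inf : q_inf / 4 < r_inf)
  (* (3) *)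
  (gamma_ratio : gamma n.+1 / gamma n @[n --> \oo] --> (1 : R))
  (gamma_sum : (\sum_(1 <= n <oo) (gamma n)%:E = +oo)%E)
  (gamma_sq_sum : (\sum_(1 <= n <oo) (gamma n ^+ 2)%:E < +oo)%E)
  (* (4) *)
  (grad_mom4 : forall K : set 'rV[R]_d, compact K ->
     (ereal_sup [set \int[mu]_s (enorm (grad (f ^~ s) x) ^+ 4)%:E | x in K]
      < +oo)%E)
  (* (5) *)
  (gradF_lip : exists L : R, forall x y,
     enorm (grad F x - grad F y) <= L * enorm (x - y))
  (* (6) *)
  (grad_mom2 : exists2 C : R, 0 < C & forall x,
     (\int[mu]_s (enorm (grad (f ^~ s) x) ^+ 2)%:E <= (C * (1 + F x))%:E)%E) :
  {ae P, forall w,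
     bounded_fun (alg f eps gamma (coef gamma h0 h) (coef gamma r0 r)
       (coef gamma p0 p) (coef gamma q0 q) (fun n => xi n w) (v0, m0, x0))}.
Proof.

(* Regularity of [F] and second moments *)
pose X n := xi n.+1.
have X_law n A : measurable A -> P (X n @^-1` A) = mu A by exact: xi_law.
have lip x : exists2 e : R, 0 < e & forall s u v, eball x e u -> eball x e v ->
    enorm (grad (f ^~ s) u - grad (f ^~ s) v) <= kappa x s * enorm (u - v).
  have [e e0 h1] := grad_loc_lip x; exists e => // s u v xu xv.
  by apply: le_trans (h1 s u v xu xv); rewrite le_max lexx.
have gradFE x j : grad F x 0 j = \int[mu]_s grad (f ^~ s) x 0 j.
  by rewrite (grad_expectation f_meas f_int f_diff grad_sq_int kappa_ge0
    kappa_int lip F_def) mxE.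
have [L L0 F_lip] : exists2 L : R, 0 <= L &
    forall x y, enorm (grad F x - grad F y) <= L * enorm (x - y).
  have [L FL] := gradF_lip; exists `|L| => // x y; apply: le_trans (FL x y) _.
  by rewrite ler_wpM2r ?enorm_ge0// ler_norm.
have F_descent := expectation_descent f_meas f_int f_diff grad_sq_int kappa_ge0
  kappa_int lip F_def F_lip L0.
have grad_int := integrable_grad f_meas f_diff grad_sq_int.
have sq_int x j : mu.-integrable setT (fun s => (grad (f ^~ s) x 0 j ^+ 2)%:E).
  by have := grad_sq_int x j; under eq_fun do rewrite hpowE.
have [C C0 mom2] := grad_mom2.
have sum_mom2 x : \sum_(j < d) \int[mu]_s (grad (f ^~ s) x 0 j ^+ 2) <= C * (1 + F x).
  rewrite -Rintegral_sum; last by move=> j; exact: sq_int.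
  rewrite -lee_fin /Rintegral fineK; last first.
    by apply: integrable_fin_num => //; apply: integrable_sum_EFin => j; exact: sq_int.
  apply: le_trans (mom2 x); rewrite le_eqVlt; apply/orP; left; apply/eqP.
  by apply: eq_integral => s _; rewrite enorm_sq.
have F_ge x : 0 <= 1 + F x.
  rewrite -(pmulr_rge0 _ C0); apply: le_trans (sum_mom2 x); apply: sumr_ge0 => j _.
  by apply: Rintegral_ge0 => s _; exact: sqr_ge0.

(* The iterates as a process adapted to the histories *)
pose step n s z := alg_step f eps (gamma n.+1) (coef gamma h0 h n) (coef gamma r0 r n)
  (coef gamma p0 p n) (coef gamma q0 q n) s z.
pose Z n w := alg f eps gamma (coef gamma h0 h) (coef gamma r0 r) (coef gamma p0 p)
  (coef gamma q0 q) (fun n => xi n w) (v0, m0, x0) n.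
have ZE n w : Z n.+1 w = step n (X n w) (Z n w) by [].
have mstep n : @measurable_state R d _ (g_sigma_algebraType (cylinder X n)) (Z n) ->
    @measurable_state R d _ (g_sigma_algebraType (cylinder X n) * Xi)%type
      (fun u => step n u.2 (Z n u.1)).
  move=> mZ; apply: measurable_alg_step => // j; have [m1 m2 m3] := mZ j.
  by split; [exact: (measurableT_comp m1)|exact: (measurableT_comp m2)|
    exact: (measurableT_comp m3)].
have mZ n : @measurable_state R d _ (g_sigma_algebraType (cylinder X n)) (Z n).
  elim: n => [|n IH] j; first by split; exact: measurable_cst.
  have [m1 m2 m3] := mstep n IH j.
  have mX := @measurable_history_step _ _ _ _ _ P X n.
  by split; [exact: (measurableT_comp m1 mX)|exact: (measurableT_comp m2 mX)|
    exact: (measurableT_comp m3 mX)].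
have mstep1 n z : @measurable_state R d _ Xi (fun s => step n s z).
  by apply: (@measurable_alg_step _ _ _ _ f f_meas f_diff eps _ _ _ _ _ _ _
    id (fun=> z)) => // j;
    split; exact: measurable_cst.
have coef_ge0 c0 c : 0 < c0 -> (forall t, 0 < t -> 0 <= c t) ->
    forall n, 0 <= coef gamma c0 c n.
  by move=> c00 cge [|n] /=; [exact: ltW|exact/cge/tau_gt0].
have h_ge := coef_ge0 _ _ h0_gt0 h_ge0; have p_ge := coef_ge0 _ _ p0_gt0 p_ge0.
have Zv n w j : 0 <= (Z n w).1.1 0 j.
  elim: n j => [|n IH] j; first exact: v0_ge0.
  rewrite ZE step_v; apply: addr_ge0; first by apply: mulr_ge0.
  by apply: mulr_ge0; [apply: mulr_ge0 => //; exact/ltW/gamma_gt0|exact: sqr_ge0].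

(* Uniform bounds on steps and coefficients from [n0] on *)
have h_noninc (s t : R) : 0 < s -> s <= t -> h t <= h s.
  move=> s0 st; apply: (@ler0_derive1_nincry R h s _ _ _ s t) => //.
  - by move=> x /[!in_itv]/= /andP[sx _]; apply: h_derivable; exact: lt_trans sx.
  - by move=> x /[!in_itv]/= /andP[sx _]; apply: h_deriv_le0; exact: lt_trans sx.
  - apply: derivable_within_continuous => x /[!in_itv]/= /andP[sx _].
    by apply: h_derivable; exact: lt_le_trans sx.
have h_ge_inf := nonincreasing_ge_lim h_noninc h_lim.
have q_ge_inf := nonincreasing_ge_lim q_noninc q_lim.
pose hmax := h (tau gamma 1); pose qmax := q (tau gamma 1); pose rmax := r (tau gamma 1).
have tau1 : 0 < tau gamma 1 by exact: tau_gt0.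
have hmax0 : 0 <= hmax by exact: h_ge0.
have qmax0 : 0 <= qmax by exact: q_ge0.
have rmax0 : 0 <= rmax by exact: r_ge0.
(* The three entries enforce [ga <= 1], [ga * q <= 1/2] and [ga * r <= 1]; the added ones keep the
   inverses meaningful. *)
pose delta := Num.min 1 (Num.min (2 * (qmax + 1))^-1 (rmax + 1)^-1).
have delta0 : 0 < delta.
  by rewrite !lt_min ltr01 !invr_gt0 mulr_gt0//= ltr_wpDl.
have [N1 gamma_le] := gamma_small gamma_gt0 gamma_sq_sum delta0.
pose pmax := `|p_inf| + 1.
have [N2 p_le] : exists N, forall n, (N <= n)%N -> p (tau gamma n) <= pmax.
  have /cvgrPdist_lt /(_ 1 ltr01) [T [_ HT]] := p_lim.
  have [N TN] := tau_unbounded gamma_gt0 T gamma_sum.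
  exists N => n Nn; have := HT (tau gamma n) (lt_le_trans TN (tau_le gamma_gt0 Nn)).
  rewrite /= distrC ltr_norml => /andP[_ /ltW]; rewrite lerBlDl => /le_trans; apply.
  by rewrite lerD2r ler_norm.
pose n0 := maxn 1 (maxn N1 N2).
have n0_1 n : (n0 <= n)%N -> (1 <= n)%N by rewrite geq_max => /andP[].
have coefE c0 c n : (n0 <= n)%N -> coef gamma c0 c n = c (tau gamma n).
  by move=> /n0_1; case: n.
have tau_ge1 n : (n0 <= n)%N -> tau gamma 1 <= tau gamma n.
  by move=> /n0_1; exact: tau_le.
have gamma_n0 n : (n0 <= n)%N -> gamma n.+1 <= delta.
  by move=> n0n; apply: gamma_le; apply: leq_trans n0n; rewrite /n0 !leq_max leqnn orbT.
have g0 n : 0 <= gamma n.+1 by exact/ltW/gamma_gt0.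
have g_le1 n : (n0 <= n)%N -> 0 <= gamma n.+1 <= 1.
  move=> /gamma_n0 gd; rewrite g0 /= (le_trans gd)//.
  by rewrite ge_min lexx.
have h_bnd n : (n0 <= n)%N -> 0 <= coef gamma h0 h n <= hmax.
  by move=> n0n; rewrite h_ge /= coefE// h_noninc// tau_ge1.
have q_bnd n : (n0 <= n)%N -> q_inf <= coef gamma q0 q n <= qmax.
  move=> n0n; rewrite coefE// q_noninc ?tau_ge1// andbT; apply: q_ge_inf.
  exact/tau_gt0/n0_1.
have q_bnd0 n : (n0 <= n)%N -> 0 <= coef gamma q0 q n <= qmax.
  by move=> /q_bnd /andP[q1 ->]; rewrite (le_trans _ q1)// ltW.
have p_bnd n : (n0 <= n)%N -> 0 <= coef gamma p0 p n <= pmax.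
  move=> n0n; rewrite p_ge /= coefE//; apply: p_le; apply: leq_trans n0n.
  by rewrite /n0 !leq_max leqnn !orbT.
have gq n : (n0 <= n)%N -> gamma n.+1 * coef gamma q0 q n <= 2^-1.
  move=> n0n; have /andP[q1 q2] := q_bnd0 n n0n.
  apply: (@le_trans _ _ ((2 * (qmax + 1))^-1 * qmax)).
    apply: ler_pM => //; apply: le_trans (gamma_n0 n n0n) _.
    by rewrite !ge_min lexx orbT.
  by rewrite ler_pdivrMl ?mulr_gt0 ?ltr_wpDl//; lra.
have gr n : (n0 <= n)%N -> gamma n.+1 * coef gamma r0 r n <= 1.
  move=> n0n; apply: (@le_trans _ _ ((rmax + 1)^-1 * rmax)).
    rewrite coefE//; apply: ler_pM => //; [exact/r_ge0/tau_gt0/n0_1| |].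
      by apply: le_trans (gamma_n0 n n0n) _; rewrite !ge_min lexx !orbT.
    by apply: r_noninc => //; exact: tau_ge1.
  by rewrite ler_pdivrMl ?ltr_wpDl//; lra.
have qr n : (n0 <= n)%N -> coef gamma q0 q n / 4 <= coef gamma r0 r n.
  by move=> n0n; rewrite !coefE//; exact/r_ge_q4/tau_gt0/n0_1.
have [Bg sumB] := gamma_sq_bounded gamma_sq_sum.
have prod_le (rate : R) : 0 <= rate -> forall n,
    \prod_(k < n) (1 + rate * gamma (n0 + k).+1 ^+ 2) <= expR (rate * Bg).
  move=> rate0; apply: (@prod_1D_le _ (fun k => rate * gamma (n0 + k).+1 ^+ 2)) => n.
    by apply: mulr_ge0 => //; exact: sqr_ge0.
  by rewrite -mulr_sumr ler_wpM2l.

(* Almost sure boundedness of the energy *)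
have ae_energy : {ae P, forall w, exists M, forall n, (n0 <= n)%N ->
    energy F eps (coef gamma h0 h n) (Z n w) <= M}.
  pose rate := energy_rate eps (d%:R * L) C hmax qmax.
  have rate0 : 0 <= rate.
    by have C0' := ltW C0; rewrite /rate /energy_rate /=; nonneg.
  have mF := measurable_expectation f_meas F_def.
  have main := @lyapunov_ae_bounded _ _ _ _ _ _ P mu X X_law xi_indep step Z ZE
    (fun n => energy F eps (coef gamma h0 h n))
    (fun=> [set z : 'rV[R]_d * 'rV[R]_d * 'rV[R]_d | forall j, 0 <= z.1.1 0 j])
    (fun n => rate * gamma n.+1 ^+ 2) n0
    (expR (rate * Bg)) _ _ _ _ _ (prod_le rate rate0) _.
  have : {ae P, forall w, (forall n, (n0 <= n)%N -> forall j, 0 <= (Z n w).1.1 0 j) ->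
     exists M, forall n, (n0 <= n)%N -> energy F eps (coef gamma h0 h n) (Z n w) <= M}.
    apply: main => [n z|n|n|n|n|n z n0n v0z].
    - exact: energy_ge0.
    - by apply: measurable_energy => //; exact: mZ.
    - apply: measurable_energy => //; exact: mstep.
    - rewrite (_ : [set _ | _] = setT).
        exact: (@measurableT _ (g_sigma_algebraType (cylinder X n))).
      by apply/seteqP; split => w //= _ j; exact: Zv.
    - by apply: mulr_ge0 => //; exact: sqr_ge0.
    (* The weight [h_(n+1)] is replaced by the larger [h_n], which is legitimate because
       [1 + F >= 0] and [n >= 1]. *)
    - apply: (@le_trans _ _ (\int[mu]_s (energy F eps (coef gamma h0 h n) (step n s z))%:E)%E).
        apply: ge0_le_integral => //.
        + by move=> s _; rewrite lee_fin energy_ge0.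
        + by apply/measurable_EFinP; apply: measurable_energy => //; exact: mstep1.
        + by apply/measurable_EFinP; apply: measurable_energy => //; exact: mstep1.
        + move=> s _; rewrite lee_fin /energy lerD2r ler_wpM2r// !coefE//; last exact: leqW.
          by apply: h_noninc; [exact/tau_gt0/n0_1|exact: tau_le].
      apply: (@energy_mean_step R d _ Xi mu f F eps eps_gt0 (d%:R * L) C) => //.
      + exact: mulr_ge0.
      + exact: ltW.
      + exact: g_le1.
      + exact: h_bnd.
      + exact: q_bnd0.
      + exact: gq.
      + exact: gr.
      + exact: qr.
      + by apply: measurable_energy => //; exact: mstep1.
  by apply: filterS => w; apply => n n0n j; exact: Zv.

(* Almost sure boundedness of [v] as long as [x] stays in a box *)
have mgrad := measurable_grad f_meas f_diff.
have mom4 (k : nat) : exists S4 : R, forall (x : 'rV[R]_d) j, (forall i, `|x 0 i| <= k%:R) ->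
    mu.-integrable setT (EFin \o (fun s => (grad (f ^~ s) x 0 j ^+ 2) ^+ 2)) /\
    \int[mu]_s ((grad (f ^~ s) x 0 j ^+ 2) ^+ 2) <= S4.
  set I := fun x => (\int[mu]_s (enorm (grad (f ^~ s) x) ^+ 4)%:E)%E.
  have := grad_mom4 _ (@compact_box R d k%:R); rewrite -/I.
  set K := [set x | _]; set sup := ereal_sup _ => sup_fin.
  have sup0 : (0 <= sup)%E.
    apply: (@le_trans _ _ (I 0)).
      by apply: integral_ge0 => s _; rewrite lee_fin exprn_ge0// enorm_ge0.
    by apply: ereal_sup_ubound; exists 0 => // i; rewrite mxE normr0.
  exists (fine sup) => x j xK.
  have mg4 : measurable_fun setT (fun s => (grad (f ^~ s) x 0 j ^+ 2) ^+ 2).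
    by do 2!apply: measurable_funX; exact: mgrad.
  have me4 : measurable_fun setT (fun s => enorm (grad (f ^~ s) x) ^+ 4).
    have -> : (fun s => enorm (grad (f ^~ s) x) ^+ 4) =
        (fun s => (\sum_(i < d) grad (f ^~ s) x 0 i ^+ 2) ^+ 2).
      by apply/funext => s; rewrite -enorm_sq -exprM.
    by apply: measurable_funX; apply: measurable_sum => i; apply: measurable_funX; exact: mgrad.
  have le_sup : (\int[mu]_s ((grad (f ^~ s) x 0 j ^+ 2) ^+ 2)%:E <= sup)%E.
    apply: (@le_trans _ _ (I x)); last by apply: ereal_sup_ubound; exists x.
    apply: ge0_le_integral => //.
    - by move=> s _; rewrite lee_fin sqr_ge0.
    - exact/measurable_EFinP.
    - exact/measurable_EFinP.
    - move=> s _; rewrite lee_fin -[4%N]/(2 * 2)%N exprM.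
      rewrite ler_sqr ?nnegrE ?sqr_ge0// enorm_sq (bigD1 j)//= lerDl.
      by apply: sumr_ge0 => i _; exact: sqr_ge0.
  have ig4 : mu.-integrable setT (EFin \o (fun s => (grad (f ^~ s) x 0 j ^+ 2) ^+ 2)).
    apply/integrableP; split; first exact/measurable_EFinP.
    under eq_integral do rewrite /= ger0_norm ?sqr_ge0//.
    exact: le_lt_trans le_sup sup_fin.
  split => //; rewrite -lee_fin /Rintegral fineK; last exact: integrable_fin_num.
  by rewrite fineK// ge0_fin_numE.
have ae_v (k : nat) (j : 'I_d) : {ae P, forall w,
    (forall n, (n0 <= n)%N -> forall i, `|(Z n w).2 0 i| <= k%:R) ->
    exists M, forall n, (n0 <= n)%N -> `|(Z n w).1.1 0 j| <= M}.
  (* Second moments are controlled by fourth ones through [t <= 1 + t^2] with [t] the squared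
     gradient coordinate. *)
  have [S4 HS4] := mom4 k; pose S2 := 1 + S4.
  have S40 : 0 <= S4.
    have [|i4 i4S] := HS4 0 j; first by move=> i; rewrite mxE normr0.
    by apply: le_trans i4S; apply: Rintegral_ge0 => s _; exact: sqr_ge0.
  pose c := pmax * S2 / q_inf.
  pose rate := 2 * pmax ^+ 2 * S4 + 4 * qmax ^+ 2 * (1 + c ^+ 2).
  have rate0 : 0 <= rate by rewrite /rate; nonneg.
  have main := @lyapunov_ae_bounded _ _ _ _ _ _ P mu X X_law xi_indep step Z ZE
    (fun=> excess c j)
    (fun=> [set z : 'rV[R]_d * 'rV[R]_d * 'rV[R]_d |
       0 <= z.1.1 0 j /\ forall i, `|z.2 0 i| <= k%:R])
    (fun n => rate * gamma n.+1 ^+ 2) n0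
    (expR (rate * Bg)) _ _ _ _ _ (prod_le rate rate0) _.
  have : {ae P, forall w, (forall n, (n0 <= n)%N ->
      0 <= (Z n w).1.1 0 j /\ forall i, `|(Z n w).2 0 i| <= k%:R) ->
     exists M, forall n, (n0 <= n)%N -> excess c j (Z n w) <= M}.
    apply: main => [n z|n|n|n|n|n z n0n [v0z xz]].
    - exact: excess_ge0.
    - by apply: measurable_excess; exact: mZ.
    - by apply: measurable_excess; exact: mstep.
    - suff : (@measurable _ (g_sigma_algebraType (cylinder X n)))
          [set w | forall i, `|(Z n w).2 0 i| <= k%:R].
        congr (measurable _); apply/seteqP; split => w /=; last by case.
        by split => //; exact: Zv.
      have -> : [set w | forall i, `|(Z n w).2 0 i| <= k%:R] =
          \bigcap_(i in [set: 'I_d]) [set w | `|(Z n w).2 0 i| <= k%:R].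
        by apply/seteqP; split => w /= hw i => [_|]; exact: hw.
      apply: fin_bigcap_measurable => [|i _]; first exact: finite_finset.
      have [_ _ m3] := mZ n i.
      have m3' : @measurable_fun _ _ (g_sigma_algebraType (cylinder X n)) R setT
          (fun w => `|(Z n w).2 0 i|) by apply: measurableT_comp.
      have := m3' measurableT [set` `]-oo, (k%:R : R)]] (measurable_itv _).
      by rewrite setTI; congr (measurable _); apply/seteqP; split => w /=; rewrite in_itv.
    - by apply: mulr_ge0 => //; exact: sqr_ge0.
    - have [i4 i4S] := HS4 z.2 j xz.
      apply: (@excess_mean_step R d _ Xi mu f eps sq_int _ _ _ _ _
        S2 S4 pmax q_inf qmax c) => //.
      + exact: p_bnd.
      + exact: q_bnd.
      + apply: (@le_trans _ _ (\int[mu]_s (1 + (grad (f ^~ s) z.2 0 j ^+ 2) ^+ 2))).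
          apply: le_Rintegral => //; first exact: sq_int.
            by apply: integrableD_EFin => //; exact: integrable_cst_EFin.
          by move=> s _; have := sqr_ge0 (grad (f ^~ s) z.2 0 j ^+ 2 - 1); nra.
        rewrite RintegralD//; last exact: integrable_cst_EFin.
        by rewrite Rintegral_cst_prob lerD2l.
      + by apply: measurable_excess; exact: mstep1.
  apply: filterS => w hw xw; have [|M HM] := hw.
    by move=> n n0n; split; [exact: Zv|exact: xw].
  exists (M + c) => n n0n; rewrite ger0_norm; last exact: Zv.
  have := HM n n0n; rewrite /excess; set y := _ - c => My.
  have yle : y <= Num.max 0 y by rewrite le_max lexx orbT.
  (* Since [t <= t^2 + 1/4], the bound [1 + max(0, y)^2 <= M] gives [y <= M]. *)
  have := sqr_ge0 (Num.max 0 y - 2^-1); rewrite -lerBlDr -/y; nra.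
(* The box containing the trajectory depends on [w], so a single null set must serve all radii [k];
   there are countably many. *)
have ae_v_all : {ae P, forall w, forall (k : nat) (j : 'I_d),
    (forall n, (n0 <= n)%N -> forall i, `|(Z n w).2 0 i| <= k%:R) ->
    exists M, forall n, (n0 <= n)%N -> `|(Z n w).1.1 0 j| <= M}.
  apply/ae_foralln => k; apply: filter_forall => j; exact: ae_v.

(* Deterministic bounds along one trajectory *)
apply: filterS2 ae_energy ae_v_all => w [M1 HM1] hv.
have M1_ge0 : 0 <= M1.
  apply: le_trans (HM1 n0 (leqnn _)); exact: energy_ge0.
have kin_ge0 n j : 0 <= 2^-1 * (Z n w).1.2 0 j ^+ 2 * (Num.sqrt ((Z n w).1.1 0 j + eps))^-1.
  by nonneg.
have F_le n : (n0 <= n)%N -> 1 + F (Z n w).2 <= M1 / h_inf.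
  move=> n0n; rewrite ler_pdivlMr// mulrC.
  have h1 : h_inf <= coef gamma h0 h n by rewrite coefE//; exact/h_ge_inf/tau_gt0/n0_1.
  apply: le_trans (ler_wpM2r (F_ge _) h1) _; apply: le_trans (HM1 n n0n).
  by rewrite /energy lerDl; apply: sumr_ge0 => j _.
(* Outside radius [B], [F] would be at least [M1 / h_inf], whereas [1 + F] is at most that along the
   trajectory. *)
have [B HB] := F_coercive (M1 / h_inf).
pose k := (Num.truncn `|B|).+1.
have x_le n : (n0 <= n)%N -> forall i, `|(Z n w).2 0 i| <= k%:R.
  move=> n0n i; apply: le_trans (coord_le_enorm _ _) _.
  apply: (@le_trans _ _ `|B|); last by apply: ltW; exact: truncnS_gt.
  rewrite leNgt; apply/negP => /ltW xB.
  have := HB _ (le_trans (ler_norm B) xB); have := F_le n n0n; lra.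
have /choice[Mv HMv] : forall j : 'I_d, exists M, forall n, (n0 <= n)%N ->
    `|(Z n w).1.1 0 j| <= M.
  by move=> j; exact: (hv k j x_le).
pose V := \sum_(j < d) `|Mv j|.
have V0 : 0 <= V by apply: sumr_ge0.
have v_le n j : (n0 <= n)%N -> `|(Z n w).1.1 0 j| <= V.
  move=> n0n; apply: le_trans (HMv j n n0n) _; apply: le_trans (ler_norm _) _.
  by rewrite /V (bigD1 j)//= lerDl sumr_ge0.
(* The energy bounds [m^2] by [2 M1 sqrt (V + eps)] in each coordinate, and [|m| <= 1 + m^2]. *)
pose W := 1 + 2 * M1 * Num.sqrt (V + eps).
have W0 : 0 <= W by rewrite /W; nonneg.
have m_le n j : (n0 <= n)%N -> `|(Z n w).1.2 0 j| <= W.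
  move=> n0n; set y := (Z n w).1.2 0 j.
  have s0 : 0 < Num.sqrt ((Z n w).1.1 0 j + eps).
    by rewrite sqrtr_gt0 ltr_wpDl.
  have E : 2^-1 * y ^+ 2 * (Num.sqrt ((Z n w).1.1 0 j + eps))^-1 <= M1.
    apply: le_trans (HM1 n n0n); rewrite /energy (bigD1 j)//= addrCA lerDl.
    apply: addr_ge0; first exact: mulr_ge0.
    by apply: sumr_ge0 => i _.
  rewrite ler_pdivrMr// in E.
  have sV : Num.sqrt ((Z n w).1.1 0 j + eps) <= Num.sqrt (V + eps).
    by rewrite ler_wsqrtr// lerD2r; apply: le_trans (ler_norm _) (v_le n j n0n).
  have := ler_wpM2l M1_ge0 sV; rewrite /W -(real_normK (num_real y)) in E *.
  have := sqr_ge0 (`|y| - 1); have := normr_ge0 y; nra.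
apply: (@eventually_bounded_fun _ _ _ n0 (V + W + k%:R)) => n n0n.
apply: norm_triple_le; first by nonneg.
move=> j; split.
- by apply: le_trans (v_le n j n0n) _; rewrite -addrA lerDl addr_ge0.
- by apply: le_trans (m_le n j n0n) _; rewrite addrAC lerDr addr_ge0.
- by apply: le_trans (x_le n n0n j) _; rewrite lerDr addr_ge0.
Qed.
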